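(* Let $\Psi$ be a unit-length generalized Killing spinor on the round sphere $\mathbb{S}^3$, written as $\Psi=V\cdot\Phi+\alpha\Phi$ with $\Phi=[\tilde u,1]$, $V$ a vector field and $\alpha$ a function. If $\alpha$ is constant, then either $\Psi$ is a Killing spinor with Killing constant $\tfrac12$ (i.e. $\nabla_X\Psi=\tfrac12X\cdot\Psi$ for all $X$), or $\alpha=0$ and $\Psi=\xi\cdot\Phi$ for a right-invariant unit vector field $\xi$ (i.e. $\xi_g=bg$ for some unit $b\in\mathrm{Im}\,\mathbb{H}$), so that $\Psi$ is the Clifford product of a right-invariant vector field with a Killing spinor of constant $\tfrac12$.
   Context: $\mathbb{S}^3\subset\mathbb{H}$ is the unit sphere with round metric and group structure, $u(g)=(gi,gj,gk)$ the left-invariant orthonormal frame defining the orientation, $\tilde u$ a lift to the spin bundle; spinors are $[\tilde u,f]$ with $f:\mathbb{S}^3\to\mathbb{H}$ and Clifford multiplication by $gx$ acting by $f\mapsto xf$. $\Phi=[\tilde u,1]$ satisfies $\nabla_X\Phi=\tfrac12X\cdot\Phi$. Every spinor can be uniquely written as $V\cdot\Phi+\alpha\Phi$ with $V$ a vector field and $\alpha$ a real function. A generalized Killing spinor is $\Psi$ with $\nabla_X\Psi=A(X)\cdot\Psi$ for all $X$, for some symmetric endomorphism field $A$. *)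

(* Defs.v *)
From Stdlib Require Import Reals.
Open Scope R_scope.

Record quat : Type := mkQ { q0 : R; q1 : R; q2 : R; q3 : R }.

Definition qadd (p q : quat) : quat :=
  mkQ (q0 p + q0 q) (q1 p + q1 q) (q2 p + q2 q) (q3 p + q3 q).
Definition qscale (r : R) (q : quat) : quat :=
  mkQ (r * q0 q) (r * q1 q) (r * q2 q) (r * q3 q).
Definition qreal (r : R) : quat := mkQ r 0 0 0.
Definition qone : quat := qreal 1.
Definition qmul (p q : quat) : quat :=
  mkQ (q0 p * q0 q - q1 p * q1 q - q2 p * q2 q - q3 p * q3 q)
      (q0 p * q1 q + q1 p * q0 q + q2 p * q3 q - q3 p * q2 q)
      (q0 p * q2 q - q1 p * q3 q + q2 p * q0 q + q3 p * q1 q)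
      (q0 p * q3 q + q1 p * q2 q - q2 p * q1 q + q3 p * q0 q).
Definition qconj (q : quat) : quat := mkQ (q0 q) (- q1 q) (- q2 q) (- q3 q).
Definition qdot (p q : quat) : R :=
  q0 p * q0 q + q1 p * q1 q + q2 p * q2 q + q3 p * q3 q.
Definition qnorm (q : quat) : R := sqrt (qdot q q).

Definition onS3 (g : quat) : Prop := qnorm g = 1.
Definition tangent (g X : quat) : Prop := qdot g X = 0.

Definition cont_on_R4 (h : quat -> R) : Prop :=
  forall x eps, 0 < eps -> exists delta, 0 < delta /\
    forall y, qnorm (qadd y (qscale (-1) x)) < delta -> Rabs (h y - h x) < eps.

Definition basis4 (n : nat) : quat :=
  match n with
  | 0 => mkQ 1 0 0 0 | 1 => mkQ 0 1 0 0 | 2 => mkQ 0 0 1 0 | _ => mkQ 0 0 0 1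
  end.

Fixpoint Ck (n : nat) (h : quat -> R) : Prop :=
  match n with
  | O => cont_on_R4 h
  | S m => cont_on_R4 h /\
      forall e : nat, (e < 4)%nat -> exists dh : quat -> R,
        (forall x, derivable_pt_lim (fun t => h (qadd x (qscale t (basis4 e)))) 0 (dh x))
        /\ Ck m dh
  end.

Definition smooth_R4 (h : quat -> R) : Prop := forall n, Ck n h.

(** A spinor [u~, f] is encoded by f : H -> H, only values on S^3 matter;
    smoothness of f on S^3 is expressed as f being (the restriction of)
    a smooth map R^4 -> R^4. *)
Definition smooth_spinor (f : quat -> quat) : Prop :=
  smooth_R4 (fun x => q0 (f x)) /\ smooth_R4 (fun x => q1 (f x)) /\
  smooth_R4 (fun x => q2 (f x)) /\ smooth_R4 (fun x => q3 (f x)).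

Definition dirderiv (f : quat -> quat) (g X d : quat) : Prop :=
  derivable_pt_lim (fun t => q0 (f (qadd g (qscale t X)))) 0 (q0 d) /\
  derivable_pt_lim (fun t => q1 (f (qadd g (qscale t X)))) 0 (q1 d) /\
  derivable_pt_lim (fun t => q2 (f (qadd g (qscale t X)))) 0 (q2 d) /\
  derivable_pt_lim (fun t => q3 (f (qadd g (qscale t X)))) 0 (q3 d).

(** Clifford multiplication of the tangent vector X = g x (x = conj(g) X)
    on the spinor [u~, s] at g : gives [u~, x s]. *)
Definition cliff (g X s : quat) : quat := qmul (qmul (qconj g) X) s.

(** Spinor covariant derivative in the trivialisation:
    nabla_X [u~, f] = [u~, df(X) + 1/2 X . f]  (forced by nabla_X Phi = 1/2 X . Phi,
    since the connection acts by left Clifford multiplication).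
    [nabla_at f g X s] means (nabla_X Psi)(g) = [u~, s]. *)
Definition nabla_at (f : quat -> quat) (g X s : quat) : Prop :=
  exists d, dirderiv f g X d /\ s = qadd d (qscale (1/2) (cliff g X (f g))).

(** Decomposition Psi = V.Phi + alpha Phi, with Phi = [u~, 1]:
    f = conj(g) V_g + alpha, so alpha = Re f and V_g = g Im f. *)
Definition spinor_alpha (f : quat -> quat) (g : quat) : R := q0 (f g).
Definition spinor_V (f : quat -> quat) (g : quat) : quat :=
  qmul g (mkQ 0 (q1 (f g)) (q2 (f g)) (q3 (f g))).

Definition unit_length (f : quat -> quat) : Prop :=
  forall g, onS3 g -> qnorm (f g) = 1.

Definition sym_endo_field (A : quat -> quat -> quat) : Prop :=
  forall g, onS3 g ->
    (forall X, tangent g X -> tangent g (A g X)) /\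
    (forall X Y, tangent g X -> tangent g Y -> A g (qadd X Y) = qadd (A g X) (A g Y)) /\
    (forall r X, tangent g X -> A g (qscale r X) = qscale r (A g X)) /\
    (forall X Y, tangent g X -> tangent g Y -> qdot (A g X) Y = qdot X (A g Y)).

Definition gen_killing (f : quat -> quat) : Prop :=
  exists A, sym_endo_field A /\
    forall g X, onS3 g -> tangent g X -> nabla_at f g X (cliff g (A g X) (f g)).

Definition killing (f : quat -> quat) (c : R) : Prop :=
  forall g X, onS3 g -> tangent g X -> nabla_at f g X (qscale c (cliff g X (f g))).

(* Main.v *)
Require Import Defs.
From Stdlib Require Import Reals Lra Lia List.
From Stdlib Require Import FunctionalExtensionality ProofIrrelevance ClassicalEpsilon.
From Coquelicot Require Import Coquelicot.
Open Scope R_scope.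

(** Write [f = alpha + v] and let [E_x] be the left-invariant field [g |-> g x]. The generalized
    Killing equation says [E_x f = B(x) f] with [B] symmetric. Since [alpha] is constant,
    [B v = 0]; hence [v] has constant length [r], [E_v v = 0] and [alpha curl v + v div v = 0].
    If [r = 0] then [f] is constant. At a point, use an orthonormal left-invariant frame whose
    first vector is [v / r], and let [p = (x, y; z, t)] be the derivative of [v] on the
    orthogonal plane. It satisfies a matrix Riccati equation along [v].

    If [alpha <> 0] and [r > 0], two derivatives along [v] of the scalar constraint
    [alpha <v, curl v> + r^2 div v = 0] contradict the Riccati equation unless [p = 0], i.e.
    unless [f] is a Killing spinor.

    If [alpha = 0], then [v] is a divergence-free unit field with geodesic integral curves, and
    [p] satisfies the Monge-Ampere equation [(1 + z) (1 - y) - x^2 = 1]. With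
    [kappa = <v, curl v> = y - z] one has [kappa^2 - 4 kappa = 4 x^2 + (y + z)^2], and at a
    critical point of [kappa] where this is non-zero the linearised Monge-Ampere operator gives
    [- 2 (kappa^2 - 4 kappa)]. The maximum principle, applied where [(kappa - 2)^2] is largest,
    then forces [kappa] to be constantly [0] ([f] is a Killing spinor) or [4] (the field is
    right-invariant). *)

(** * Smooth functions on the quaternions *)

Lemma quat_ext (p q : quat) :
  q0 p = q0 q -> q1 p = q1 q -> q2 p = q2 q -> q3 p = q3 q -> p = q.
Proof. destruct p, q; simpl; intros; subst; reflexivity. Qed.

Lemma qnorm_le_sum (q : quat) :
  qnorm q <= Rabs (q0 q) + Rabs (q1 q) + Rabs (q2 q) + Rabs (q3 q).
Proof.
  unfold qnorm, qdot.
  assert (H : forall r, r * r = Rabs r * Rabs r) by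
    (intro r; rewrite <- Rabs_mult; symmetry; apply Rabs_pos_eq; nra).
  rewrite (H (q0 q)), (H (q1 q)), (H (q2 q)), (H (q3 q)).
  pose proof (Rabs_pos (q0 q)); pose proof (Rabs_pos (q1 q));
  pose proof (Rabs_pos (q2 q)); pose proof (Rabs_pos (q3 q)).
  rewrite <- (sqrt_square (Rabs (q0 q) + Rabs (q1 q) + Rabs (q2 q) + Rabs (q3 q))) by lra.
  apply sqrt_le_1_alt. nra.
Qed.

Lemma onS3_sq (g : quat) : onS3 g <-> qdot g g = 1.
Proof.
  unfold onS3, qnorm. split; intro H.
  - rewrite <- (sqrt_sqrt (qdot g g)); [rewrite H; ring|unfold qdot; nra].
  - rewrite H. apply sqrt_1.
Qed.

Definition coord (j : nat) (x : quat) : R :=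
  match j with 0 => q0 x | 1 => q1 x | 2 => q2 x | _ => q3 x end%nat.

(** Boxes instead of Euclidean balls: they fit both the mean value argument along one axis at a time
    and the compactness theorem for products of intervals. *)
Definition close (d : R) (x y : quat) : Prop := forall j, Rabs (coord j y - coord j x) < d.

Lemma close_intro d x y :
  Rabs (q0 y - q0 x) < d -> Rabs (q1 y - q1 x) < d ->
  Rabs (q2 y - q2 x) < d -> Rabs (q3 y - q3 x) < d -> close d x y.
Proof. intros ? ? ? ? [|[|[|j]]]; assumption. Qed.

Lemma cont_close (h : quat -> R) (x : quat) (eps : R) :
  cont_on_R4 h -> 0 < eps ->
  exists d, 0 < d /\ forall y, close d x y -> Rabs (h y - h x) < eps.
Proof.
  intros H He. destruct (H x eps He) as [d [Hd Hy]].
  exists (d / 4). split; [lra|]. intros y Hc. apply Hy.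
  eapply Rle_lt_trans; [apply qnorm_le_sum|]. simpl.
  pose proof (Hc 0%nat) as H0; pose proof (Hc 1%nat) as H1;
  pose proof (Hc 2%nat) as H2; pose proof (Hc 3%nat) as H3; simpl in *.
  replace (q0 y + -1 * q0 x) with (q0 y - q0 x) by ring.
  replace (q1 y + -1 * q1 x) with (q1 y - q1 x) by ring.
  replace (q2 y + -1 * q2 x) with (q2 y - q2 x) by ring.
  replace (q3 y + -1 * q3 x) with (q3 y - q3 x) by ring. lra.
Qed.

Lemma close_of_qnorm (d : R) (x y : quat) :
  qnorm (qadd y (qscale (-1) x)) < d -> close d x y.
Proof.
  intro H.
  assert (K : forall r, r * r <= qdot (qadd y (qscale (-1) x)) (qadd y (qscale (-1) x)) ->
            Rabs r < d).
  { intros r Hr. eapply Rle_lt_trans; [|exact H].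
    rewrite <- sqrt_Rsqr_abs. apply sqrt_le_1_alt. exact Hr. }
  apply close_intro; apply K; unfold qdot; simpl;
  pose proof (Rle_0_sqr (q0 y + -1 * q0 x)); pose proof (Rle_0_sqr (q1 y + -1 * q1 x));
  pose proof (Rle_0_sqr (q2 y + -1 * q2 x)); pose proof (Rle_0_sqr (q3 y + -1 * q3 x));
  unfold Rsqr in *; lra.
Qed.

Lemma cont_of_close (h : quat -> R) :
  (forall x eps, 0 < eps -> exists d, 0 < d /\ forall y, close d x y -> Rabs (h y - h x) < eps) ->
  cont_on_R4 h.
Proof.
  intros H x eps He. destruct (H x eps He) as [d [Hd Hy]].
  exists d. split; [exact Hd|]. intros y Hn. apply Hy, close_of_qnorm, Hn.
Qed.

Lemma cont_const c : cont_on_R4 (fun _ => c).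
Proof.
  intros x eps He. exists 1. split; [lra|]. intros. rewrite Rminus_diag, Rabs_R0. exact He.
Qed.

Lemma cont_coord j : cont_on_R4 (coord j).
Proof. apply cont_of_close. intros x eps He. exists eps. split; [exact He|]. intros y Hy. apply Hy. Qed.

Lemma cont_add h k : cont_on_R4 h -> cont_on_R4 k -> cont_on_R4 (fun x => h x + k x).
Proof.
  intros Hh Hk x eps He.
  destruct (Hh x (eps/2)) as [d1 [Hd1 H1]]; [lra|].
  destruct (Hk x (eps/2)) as [d2 [Hd2 H2]]; [lra|].
  exists (Rmin d1 d2). split; [apply Rmin_pos; assumption|]. intros y Hy.
  pose proof (Rmin_l d1 d2); pose proof (Rmin_r d1 d2).
  specialize (H1 y ltac:(lra)). specialize (H2 y ltac:(lra)).
  replace (h y + k y - (h x + k x)) with ((h y - h x) + (k y - k x)) by ring.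
  eapply Rle_lt_trans; [apply Rabs_triang|]. lra.
Qed.

Lemma cont_mul h k : cont_on_R4 h -> cont_on_R4 k -> cont_on_R4 (fun x => h x * k x).
Proof.
  intros Hh Hk x eps He.
  set (M := Rabs (h x) + Rabs (k x) + 1).
  pose proof (Rabs_pos (h x)); pose proof (Rabs_pos (k x)).
  assert (HM : 1 <= M) by (unfold M; lra).
  assert (He' : 0 < Rmin 1 (eps / (2 * M))).
  { apply Rmin_pos; [lra|]. apply Rdiv_lt_0_compat; lra. }
  destruct (Hh x _ He') as [d1 [Hd1 H1]].
  destruct (Hk x _ He') as [d2 [Hd2 H2]].
  exists (Rmin d1 d2). split; [apply Rmin_pos; assumption|]. intros y Hy.
  pose proof (Rmin_l d1 d2); pose proof (Rmin_r d1 d2).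
  specialize (H1 y ltac:(lra)). specialize (H2 y ltac:(lra)).
  pose proof (Rmin_l 1 (eps / (2 * M))); pose proof (Rmin_r 1 (eps / (2 * M))).
  set (e := eps / (2 * M)) in *.
  assert (Hee : e * M = eps / 2) by (unfold e; field; lra).
  replace (h y * k y - h x * k x)
    with ((h y - h x) * (k y - k x) + (h y - h x) * k x + h x * (k y - k x)) by ring.
  eapply Rle_lt_trans; [apply Rabs_triang|].
  eapply Rle_lt_trans; [apply Rplus_le_compat_r, Rabs_triang|].
  rewrite !Rabs_mult.
  pose proof (Rabs_pos (h y - h x)); pose proof (Rabs_pos (k y - k x)).
  set (a := Rabs (h y - h x)) in *; set (b := Rabs (k y - k x)) in *.
  assert (a * b <= e * 1) by (apply Rmult_le_compat; lra).
  assert (a * Rabs (k x) <= e * Rabs (k x)) by (apply Rmult_le_compat_r; lra).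
  assert (Rabs (h x) * b <= Rabs (h x) * e) by (apply Rmult_le_compat_l; lra).
  unfold M in Hee. nra.
Qed.

(** * Partial derivatives, total differentiability and the chain rule *)

Definition pd (j : nat) (h : quat -> R) (x : quat) : R :=
  Derive (fun t => h (qadd x (qscale t (basis4 j)))) 0.

Lemma pd_unique j h x l :
  derivable_pt_lim (fun t => h (qadd x (qscale t (basis4 j)))) 0 l -> pd j h x = l.
Proof. intro H. apply is_derive_unique, is_derive_Reals, H. Qed.

Lemma Ck_pred n h : Ck (S n) h -> Ck n h.
Proof.
  revert h. induction n as [|n IH]; intros h [Hc Hd]; [exact Hc|].
  split; [exact Hc|]. intros e He. destruct (Hd e He) as [dh [H1 H2]].
  exists dh. split; [exact H1|]. apply IH, H2.
Qed.

Lemma Ck_const n c : Ck n (fun _ => c).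
Proof.
  revert c. induction n as [|n IH]; intro c; simpl; [apply cont_const|].
  split; [apply cont_const|]. intros e _. exists (fun _ => 0).
  split; [intro x; apply derivable_pt_lim_const|apply IH].
Qed.

Lemma Ck_add n h k : Ck n h -> Ck n k -> Ck n (fun x => h x + k x).
Proof.
  revert h k. induction n as [|n IH]; intros h k; simpl; [apply cont_add|].
  intros [Hh Hdh] [Hk Hdk]. split; [apply cont_add; assumption|].
  intros e He. destruct (Hdh e He) as [dh [A1 A2]]. destruct (Hdk e He) as [dk [B1 B2]].
  exists (fun x => dh x + dk x). split; [|apply IH; assumption].
  intro x. apply derivable_pt_lim_plus; [apply A1|apply B1].
Qed.

Lemma basis_shift0 x j : qadd x (qscale 0 (basis4 j)) = x.
Proof. apply quat_ext; simpl; ring. Qed.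

(** The derivative of a product contains the factors undifferentiated, so the induction lowers their
    order with [Ck_pred]. *)
Lemma Ck_mul n h k : Ck n h -> Ck n k -> Ck n (fun x => h x * k x).
Proof.
  revert h k. induction n as [|n IH]; intros h k; [apply cont_mul|].
  intros Ah Ak. pose proof (Ck_pred _ _ Ah) as Ch. pose proof (Ck_pred _ _ Ak) as Ck'.
  destruct Ah as [Hh Hdh]; destruct Ak as [Hk Hdk].
  split; [apply cont_mul; assumption|].
  intros e He. destruct (Hdh e He) as [dh [A1 A2]]. destruct (Hdk e He) as [dk [B1 B2]].
  exists (fun x => dh x * k x + h x * dk x). split.
  - intro x. pose proof (derivable_pt_lim_mult _ _ _ _ _ (A1 x) (B1 x)) as M.
    cbv beta in M. rewrite basis_shift0 in M. exact M.
  - apply Ck_add; apply IH; assumption.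
Qed.

Lemma smooth_const c : smooth_R4 (fun _ => c).
Proof. intro n; apply Ck_const. Qed.

Lemma smooth_add h k : smooth_R4 h -> smooth_R4 k -> smooth_R4 (fun x => h x + k x).
Proof. intros A B n; apply Ck_add; [apply A|apply B]. Qed.

Lemma smooth_mul h k : smooth_R4 h -> smooth_R4 k -> smooth_R4 (fun x => h x * k x).
Proof. intros A B n; apply Ck_mul; [apply A|apply B]. Qed.

Lemma smooth_coord j : smooth_R4 (coord j).
Proof.
  intros [|n]; simpl; [apply cont_coord|]. split; [apply cont_coord|].
  intros e He. exists (fun _ => coord j (basis4 e)). split; [|apply Ck_const].
  intro x.
  replace (fun t => coord j (qadd x (qscale t (basis4 e))))
    with (fun t => coord j x + t * coord j (basis4 e)).
  - apply is_derive_Reals. auto_derive; [exact I|ring].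
  - apply functional_extensionality; intro t. destruct j as [|[|[|j]]]; simpl; ring.
Qed.

Lemma smooth_pd_lim j h x : (j < 4)%nat -> smooth_R4 h ->
  derivable_pt_lim (fun t => h (qadd x (qscale t (basis4 j)))) 0 (pd j h x).
Proof.
  intros Hj H. destruct (H 1%nat) as [_ Hd]. destruct (Hd j Hj) as [dh [A _]].
  rewrite (pd_unique j h x (dh x)); apply A.
Qed.

Lemma smooth_pd j h : (j < 4)%nat -> smooth_R4 h -> smooth_R4 (pd j h).
Proof.
  intros Hj H n. destruct (H (S n)) as [_ Hd]. destruct (Hd j Hj) as [dh [A B]].
  replace (pd j h) with dh; [exact B|].
  apply functional_extensionality; intro x. symmetry. apply pd_unique, A.
Qed.

Lemma smooth_cont h : smooth_R4 h -> cont_on_R4 h.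
Proof. intro H. apply (H 0%nat). Qed.

Lemma pd_line j h x t0 : (j < 4)%nat -> smooth_R4 h ->
  is_derive (fun t => h (qadd x (qscale t (basis4 j)))) t0
            (pd j h (qadd x (qscale t0 (basis4 j)))).
Proof.
  intros Hj H.
  apply is_derive_ext with
    (fun t => (fun s => h (qadd (qadd x (qscale t0 (basis4 j))) (qscale s (basis4 j)))) (t - t0)).
  { intro t. f_equal. apply quat_ext; simpl; ring. }
  evar_last.
  - apply (is_derive_comp (fun s => h (qadd (qadd x (qscale t0 (basis4 j))) (qscale s (basis4 j))))
             (fun t => t - t0)).
    + replace (t0 - t0) with 0 by ring. apply is_derive_Reals, smooth_pd_lim; assumption.
    + auto_derive; [exact I|reflexivity].
  - unfold scal; simpl; unfold mult; simpl. ring.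
Qed.

Lemma axis_increment j h x t : (j < 4)%nat -> smooth_R4 h ->
  exists s, Rabs s <= Rabs t /\
    h (qadd x (qscale t (basis4 j))) - h x = pd j h (qadd x (qscale s (basis4 j))) * t.
Proof.
  intros Hj H.
  destruct (MVT_gen (fun t => h (qadd x (qscale t (basis4 j)))) 0 t
             (fun t => pd j h (qadd x (qscale t (basis4 j))))) as [s [Hs E]].
  - intros u _. apply pd_line; assumption.
  - intros u _. apply derivable_continuous_pt. eexists.
    apply is_derive_Reals, pd_line; assumption.
  - exists s. split.
    + revert Hs. unfold Rmin, Rmax. destruct (Rle_dec 0 t); intros.
      * rewrite !Rabs_pos_eq; lra.
      * rewrite !Rabs_left1; lra.
    + cbv beta in E. rewrite basis_shift0 in E. rewrite E. ring.
Qed.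

(** Continuous partial derivatives give a total derivative: pass from [x] to [y] by changing one
    coordinate at a time and apply the mean value theorem on each leg. *)
Lemma smooth_differentiable h x eps : smooth_R4 h -> 0 < eps ->
  exists d, 0 < d /\ forall y, close d x y ->
    Rabs (h y - h x - (pd 0 h x * (q0 y - q0 x) + pd 1 h x * (q1 y - q1 x)
                     + pd 2 h x * (q2 y - q2 x) + pd 3 h x * (q3 y - q3 x)))
    <= eps * (Rabs (q0 y - q0 x) + Rabs (q1 y - q1 x)
            + Rabs (q2 y - q2 x) + Rabs (q3 y - q3 x)).
Proof.
  intros H He.
  assert (C : forall j, (j < 4)%nat -> exists d, 0 < d /\
             forall y, close d x y -> Rabs (pd j h y - pd j h x) < eps).
  { intros j Hj. apply cont_close; [apply smooth_cont, smooth_pd; assumption|exact He]. }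
  destruct (C 0%nat) as [d0 [P0 D0]]; [lia|]. destruct (C 1%nat) as [d1 [P1 D1]]; [lia|].
  destruct (C 2%nat) as [d2 [P2 D2]]; [lia|]. destruct (C 3%nat) as [d3 [P3 D3]]; [lia|].
  exists (Rmin (Rmin d0 d1) (Rmin d2 d3)).
  split; [repeat apply Rmin_pos; assumption|].
  intros y Hy.
  pose proof (Rmin_l (Rmin d0 d1) (Rmin d2 d3)); pose proof (Rmin_r (Rmin d0 d1) (Rmin d2 d3)).
  pose proof (Rmin_l d0 d1); pose proof (Rmin_r d0 d1).
  pose proof (Rmin_l d2 d3); pose proof (Rmin_r d2 d3).
  pose proof (Hy 0%nat) as Y0; pose proof (Hy 1%nat) as Y1;
  pose proof (Hy 2%nat) as Y2; pose proof (Hy 3%nat) as Y3; simpl in Y0, Y1, Y2, Y3.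
  set (m := Rmin (Rmin d0 d1) (Rmin d2 d3)) in *.
  set (x1 := mkQ (q0 y) (q1 x) (q2 x) (q3 x)).
  set (x2 := mkQ (q0 y) (q1 y) (q2 x) (q3 x)).
  set (x3 := mkQ (q0 y) (q1 y) (q2 y) (q3 x)).
  destruct (axis_increment 0 h x (q0 y - q0 x)) as [s0 [S0 E0]]; [lia|assumption|].
  destruct (axis_increment 1 h x1 (q1 y - q1 x)) as [s1 [S1 E1]]; [lia|assumption|].
  destruct (axis_increment 2 h x2 (q2 y - q2 x)) as [s2 [S2 E2]]; [lia|assumption|].
  destruct (axis_increment 3 h x3 (q3 y - q3 x)) as [s3 [S3 E3]]; [lia|assumption|].
  replace (qadd x (qscale (q0 y - q0 x) (basis4 0))) with x1 in E0
    by (apply quat_ext; simpl; ring).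
  replace (qadd x1 (qscale (q1 y - q1 x) (basis4 1))) with x2 in E1
    by (apply quat_ext; simpl; ring).
  replace (qadd x2 (qscale (q2 y - q2 x) (basis4 2))) with x3 in E2
    by (apply quat_ext; simpl; ring).
  replace (qadd x3 (qscale (q3 y - q3 x) (basis4 3))) with y in E3
    by (apply quat_ext; simpl; ring).
  (* Coordinates that still agree with those of [x] contribute [Rabs 0] to the closeness tests
     below. *)
  assert (Z : Rabs 0 < m) by (rewrite Rabs_R0; eapply Rle_lt_trans; [apply Rabs_pos|exact Y0]).
  assert (B0 : Rabs (pd 0 h (qadd x (qscale s0 (basis4 0))) - pd 0 h x) < eps).
  { apply D0. apply close_intro; simpl;
    match goal with |- Rabs ?e < _ => ring_simplify e end; lra. }
  assert (B1 : Rabs (pd 1 h (qadd x1 (qscale s1 (basis4 1))) - pd 1 h x) < eps).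
  { apply D1. apply close_intro; simpl;
    match goal with |- Rabs ?e < _ => ring_simplify e end; lra. }
  assert (B2 : Rabs (pd 2 h (qadd x2 (qscale s2 (basis4 2))) - pd 2 h x) < eps).
  { apply D2. apply close_intro; simpl;
    match goal with |- Rabs ?e < _ => ring_simplify e end; lra. }
  assert (B3 : Rabs (pd 3 h (qadd x3 (qscale s3 (basis4 3))) - pd 3 h x) < eps).
  { apply D3. apply close_intro; simpl;
    match goal with |- Rabs ?e < _ => ring_simplify e end; lra. }
  set (a0 := pd 0 h (qadd x (qscale s0 (basis4 0)))) in *.
  set (a1 := pd 1 h (qadd x1 (qscale s1 (basis4 1)))) in *.
  set (a2 := pd 2 h (qadd x2 (qscale s2 (basis4 2)))) in *.
  set (a3 := pd 3 h (qadd x3 (qscale s3 (basis4 3)))) in *.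
  replace (h y - h x - (pd 0 h x * (q0 y - q0 x) + pd 1 h x * (q1 y - q1 x)
                     + pd 2 h x * (q2 y - q2 x) + pd 3 h x * (q3 y - q3 x)))
    with ((a0 - pd 0 h x) * (q0 y - q0 x) + (a1 - pd 1 h x) * (q1 y - q1 x)
        + (a2 - pd 2 h x) * (q2 y - q2 x) + (a3 - pd 3 h x) * (q3 y - q3 x)) by lra.
  rewrite !Rmult_plus_distr_l.
  repeat (eapply Rle_trans; [apply Rabs_triang|apply Rplus_le_compat]);
    rewrite Rabs_mult; apply Rmult_le_compat_r; try apply Rabs_pos; lra.
Qed.

Lemma chain_rule h (c : R -> quat) (t : R) (c' : quat) : smooth_R4 h ->
  derivable_pt_lim (fun s => q0 (c s)) t (q0 c') ->
  derivable_pt_lim (fun s => q1 (c s)) t (q1 c') ->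
  derivable_pt_lim (fun s => q2 (c s)) t (q2 c') ->
  derivable_pt_lim (fun s => q3 (c s)) t (q3 c') ->
  derivable_pt_lim (fun s => h (c s)) t
    (pd 0 h (c t) * q0 c' + pd 1 h (c t) * q1 c' + pd 2 h (c t) * q2 c' + pd 3 h (c t) * q3 c').
Proof.
  intros H C0 C1 C2 C3 eps He.
  set (P := Rabs (pd 0 h (c t)) + Rabs (pd 1 h (c t)) + Rabs (pd 2 h (c t)) + Rabs (pd 3 h (c t))).
  set (L := Rabs (q0 c') + Rabs (q1 c') + Rabs (q2 c') + Rabs (q3 c')).
  assert (HP : 0 <= P) by (unfold P; repeat apply Rplus_le_le_0_compat; apply Rabs_pos).
  assert (HL : 0 <= L) by (unfold L; repeat apply Rplus_le_le_0_compat; apply Rabs_pos).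
  (* Through [e1] the remainder of [h] gets half of [eps]; through [e2] the errors of the four
     difference quotients get the other half. Since [e2 <= 1], the coordinate increments of [c] add
     up to at most [(L + 4) |s|], which explains [e1] and, below, [e3]. *)
  set (e1 := eps / (2 * (L + 4))). set (e2 := Rmin 1 (eps / (2 * (P + 1)))).
  assert (He1 : 0 < e1) by (unfold e1; apply Rdiv_lt_0_compat; lra).
  assert (He2 : 0 < e2) by (unfold e2; apply Rmin_pos; [lra|apply Rdiv_lt_0_compat; lra]).
  destruct (smooth_differentiable h (c t) e1 H He1) as [d [Hd D]].
  set (e3 := d / (L + 4)).
  destruct (C0 e2 He2) as [d0 D0]. destruct (C1 e2 He2) as [d1 D1].
  destruct (C2 e2 He2) as [d2 D2]. destruct (C3 e2 He2) as [d3 D3].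
  assert (He3 : 0 < e3) by (unfold e3; apply Rdiv_lt_0_compat; lra).
  pose proof (cond_pos d0); pose proof (cond_pos d1);
  pose proof (cond_pos d2); pose proof (cond_pos d3).
  assert (Hdel : 0 < Rmin e3 (Rmin (Rmin d0 d1) (Rmin d2 d3)))
    by (repeat apply Rmin_pos; assumption).
  exists (mkposreal _ Hdel). intros s Hs0 Hs. simpl in Hs.
  pose proof (Rmin_l e3 (Rmin (Rmin d0 d1) (Rmin d2 d3))).
  pose proof (Rmin_r e3 (Rmin (Rmin d0 d1) (Rmin d2 d3))).
  pose proof (Rmin_l (Rmin d0 d1) (Rmin d2 d3)); pose proof (Rmin_r (Rmin d0 d1) (Rmin d2 d3)).
  pose proof (Rmin_l d0 d1); pose proof (Rmin_r d0 d1).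
  pose proof (Rmin_l d2 d3); pose proof (Rmin_r d2 d3).
  specialize (D0 s Hs0 ltac:(lra)). specialize (D1 s Hs0 ltac:(lra)).
  specialize (D2 s Hs0 ltac:(lra)). specialize (D3 s Hs0 ltac:(lra)).
  assert (Hm : e2 <= 1) by apply Rmin_l.
  assert (Hm' : e2 <= eps / (2 * (P + 1))) by apply Rmin_r.
  assert (As : 0 < Rabs s) by (apply Rabs_pos_lt; exact Hs0).
  set (y := c (t + s)) in *. set (x := c t) in *.
  assert (K : forall u l, Rabs (u / s - l) < e2 -> Rabs u <= (Rabs l + 1) * Rabs s).
  { intros u l Hu. replace u with ((u / s) * s) by (field; exact Hs0).
    rewrite Rabs_mult. apply Rmult_le_compat_r; [lra|].
    replace (u / s) with ((u / s - l) + l) by ring.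
    eapply Rle_trans; [apply Rabs_triang|]. lra. }
  pose proof (K _ _ D0) as K0; pose proof (K _ _ D1) as K1;
  pose proof (K _ _ D2) as K2; pose proof (K _ _ D3) as K3.
  assert (Lb : forall l, l <= L + 3 -> (l + 1) * Rabs s < d).
  { intros l Hl. apply Rle_lt_trans with ((L + 4) * Rabs s); [apply Rmult_le_compat_r; lra|].
    apply Rlt_le_trans with ((L + 4) * e3).
    - apply Rmult_lt_compat_l; lra.
    - right. unfold e3. field. lra. }
  pose proof (Rabs_pos (q0 c')); pose proof (Rabs_pos (q1 c'));
  pose proof (Rabs_pos (q2 c')); pose proof (Rabs_pos (q3 c')).
  assert (Dy := D y). lapply Dy; clear Dy; [intro Dy|].
  2: { apply close_intro; (eapply Rle_lt_trans; [eassumption|]); apply Lb; unfold L; lra. }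
  set (r := h y - h x - (pd 0 h x * (q0 y - q0 x) + pd 1 h x * (q1 y - q1 x)
                     + pd 2 h x * (q2 y - q2 x) + pd 3 h x * (q3 y - q3 x))) in *.
  replace ((h y - h x) / s - (pd 0 h x * q0 c' + pd 1 h x * q1 c' + pd 2 h x * q2 c'
             + pd 3 h x * q3 c'))
    with (r / s + (pd 0 h x * ((q0 y - q0 x) / s - q0 c') + pd 1 h x * ((q1 y - q1 x) / s - q1 c')
            + pd 2 h x * ((q2 y - q2 x) / s - q2 c') + pd 3 h x * ((q3 y - q3 x) / s - q3 c')))
    by (unfold r; field; exact Hs0).
  assert (R1 : Rabs (r / s) <= eps / 2).
  { unfold Rdiv at 1. rewrite Rabs_mult, Rabs_inv.
    apply Rmult_le_reg_r with (Rabs s); [exact As|].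
    rewrite Rmult_assoc, Rinv_l, Rmult_1_r by lra.
    eapply Rle_trans; [exact Dy|].
    apply Rle_trans with (e1 * ((L + 4) * Rabs s)).
    - apply Rmult_le_compat_l; [lra|]. unfold L. lra.
    - right. unfold e1. field. lra. }
  assert (R2 : Rabs (pd 0 h x * ((q0 y - q0 x) / s - q0 c') + pd 1 h x * ((q1 y - q1 x) / s - q1 c')
            + pd 2 h x * ((q2 y - q2 x) / s - q2 c') + pd 3 h x * ((q3 y - q3 x) / s - q3 c'))
            <= P * e2).
  { unfold P. rewrite !Rmult_plus_distr_r.
    repeat (eapply Rle_trans; [apply Rabs_triang|apply Rplus_le_compat]);
    rewrite Rabs_mult; apply Rmult_le_compat_l; try apply Rabs_pos; lra. }
  assert (R3 : P * e2 < eps / 2).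
  { apply Rle_lt_trans with (P * (eps / (2 * (P + 1)))); [apply Rmult_le_compat_l; lra|].
    apply Rlt_le_trans with ((P + 1) * (eps / (2 * (P + 1)))).
    - apply Rmult_lt_compat_r; [apply Rdiv_lt_0_compat|]; lra.
    - right. field. lra. }
  eapply Rle_lt_trans; [apply Rabs_triang|]. lra.
Qed.

Lemma continuity_2d_slice h x i j : cont_on_R4 h ->
  continuity_2d_pt (fun u v => h (qadd (qadd x (qscale u (basis4 i))) (qscale v (basis4 j)))) 0 0.
Proof.
  intros H eps.
  set (z := qadd (qadd x (qscale 0 (basis4 i))) (qscale 0 (basis4 j))).
  destruct (cont_close h z eps H (cond_pos eps)) as [d [Hd D]].
  assert (Hd2 : 0 < d / 2) by lra.
  exists (mkposreal _ Hd2). intros u v Hu Hv. simpl in Hu, Hv. apply D.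
  rewrite Rminus_0_r in Hu, Hv.
  assert (B : forall k l, Rabs (coord k (basis4 l)) <= 1).
  { intros [|[|[|k]]] [|[|[|l]]]; simpl; rewrite ?Rabs_R0, ?Rabs_R1; lra. }
  assert (Q : forall k, coord k (qadd (qadd x (qscale u (basis4 i))) (qscale v (basis4 j)))
                 - coord k z = u * coord k (basis4 i) + v * coord k (basis4 j)).
  { intros [|[|[|k]]]; unfold z; simpl; ring. }
  intro k. rewrite Q. eapply Rle_lt_trans; [apply Rabs_triang|]. rewrite !Rabs_mult.
  pose proof (B k i); pose proof (B k j).
  pose proof (Rabs_pos u); pose proof (Rabs_pos v).
  assert (Rabs u * Rabs (coord k (basis4 i)) <= Rabs u * 1) by (apply Rmult_le_compat_l; lra).
  assert (Rabs v * Rabs (coord k (basis4 j)) <= Rabs v * 1) by (apply Rmult_le_compat_l; lra).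
  lra.
Qed.

(** Schwarz's theorem on the two-parameter slice through [x]; [S] exchanges the two shifts. *)
Lemma pd_comm i j h x : (i < 4)%nat -> (j < 4)%nat -> smooth_R4 h ->
  pd i (pd j h) x = pd j (pd i h) x.
Proof.
  intros Hi Hj H.
  set (k := fun u v => h (qadd (qadd x (qscale u (basis4 i))) (qscale v (basis4 j)))).
  assert (S : forall u v, qadd (qadd x (qscale u (basis4 i))) (qscale v (basis4 j))
                        = qadd (qadd x (qscale v (basis4 j))) (qscale u (basis4 i))).
  { intros; apply quat_ext; simpl; ring. }
  assert (D1 : forall u v, is_derive (fun t => k u t) v
     (pd j h (qadd (qadd x (qscale u (basis4 i))) (qscale v (basis4 j))))).
  { intros u v. apply pd_line; assumption. }
  assert (D2 : forall u v, is_derive (fun t => k t v) u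
     (pd i h (qadd (qadd x (qscale u (basis4 i))) (qscale v (basis4 j))))).
  { intros u v. rewrite S. eapply is_derive_ext; [|apply pd_line; assumption].
    intro t. unfold k. now rewrite S. }
  assert (F1 : forall v, (fun z => Derive (fun t => k z t) v)
     = fun z => pd j h (qadd (qadd x (qscale v (basis4 j))) (qscale z (basis4 i)))).
  { intro v. apply functional_extensionality; intro z. rewrite <- S. apply is_derive_unique, D1. }
  assert (F2 : forall u, (fun z => Derive (fun t => k t z) u)
     = fun z => pd i h (qadd (qadd x (qscale u (basis4 i))) (qscale z (basis4 j)))).
  { intro u. apply functional_extensionality; intro z. apply is_derive_unique, D2. }
  assert (G1 : forall u v, is_derive (fun z => Derive (fun t => k z t) v) u
     (pd i (pd j h) (qadd (qadd x (qscale u (basis4 i))) (qscale v (basis4 j))))).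
  { intros u v. rewrite F1, S. apply pd_line; [|apply smooth_pd]; assumption. }
  assert (G2 : forall u v, is_derive (fun z => Derive (fun t => k t z) u) v
     (pd j (pd i h) (qadd (qadd x (qscale u (basis4 i))) (qscale v (basis4 j))))).
  { intros u v. rewrite F2. apply pd_line; [|apply smooth_pd]; assumption. }
  assert (X : qadd (qadd x (qscale 0 (basis4 i))) (qscale 0 (basis4 j)) = x)
    by (rewrite !basis_shift0; reflexivity).
  pose proof (is_derive_unique _ _ _ (G1 0 0)) as A1.
  pose proof (is_derive_unique _ _ _ (G2 0 0)) as A2.
  rewrite X in A1, A2. rewrite <- A1, <- A2. apply Schwarz.
  - exists (mkposreal 1 Rlt_0_1). intros u v _ _.
    repeat split; eexists; [apply D2|apply D1|apply G1|apply G2].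
  - apply continuity_2d_pt_ext with
      (fun u v => pd i (pd j h) (qadd (qadd x (qscale u (basis4 i))) (qscale v (basis4 j)))).
    + intros u v. symmetry. apply is_derive_unique, G1.
    + apply continuity_2d_slice, smooth_cont, smooth_pd; [|apply smooth_pd]; assumption.
  - apply continuity_2d_pt_ext with
      (fun u v => pd j (pd i h) (qadd (qadd x (qscale u (basis4 i))) (qscale v (basis4 j)))).
    + intros u v. symmetry. apply is_derive_unique, G2.
    + apply continuity_2d_slice, smooth_cont, smooth_pd; [|apply smooth_pd]; assumption.
Qed.

(** * Left-invariant derivations *)

(** Bundling the smoothness proof lets derivations be iterated freely, and extensional equality
    turns their rules into rewriting equations. *)
Record SF : Type := mkSF { sf :> quat -> R; sf_smooth : smooth_R4 sf }.

Lemma SF_ext (h k : SF) : (forall g, h g = k g) -> h = k.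
Proof.
  destruct h as [h Hh], k as [k Hk]; simpl; intro E.
  apply functional_extensionality in E. subst k. f_equal. apply proof_irrelevance.
Qed.

Definition sconst (c : R) : SF := mkSF _ (smooth_const c).
Definition sadd (h k : SF) : SF := mkSF _ (smooth_add h k (sf_smooth h) (sf_smooth k)).
Definition smul (h k : SF) : SF := mkSF _ (smooth_mul h k (sf_smooth h) (sf_smooth k)).
Definition sscal (c : R) (h : SF) : SF := smul (sconst c) h.
Definition scoord (j : nat) : SF := mkSF _ (smooth_coord j).

Declare Scope sf_scope.
Delimit Scope sf_scope with sf.
Bind Scope sf_scope with SF.
Infix "+" := sadd : sf_scope.
Infix "*" := smul : sf_scope.
Notation "c *: h" := (sscal c h) (at level 40) : sf_scope.
Notation "h - k" := (sadd h (sscal (-1) k)) : sf_scope.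

Lemma smooth_pd_all j h : smooth_R4 h -> smooth_R4 (pd j h).
Proof.
  intro H. destruct j as [|[|[|j]]]; try (apply smooth_pd; [lia|exact H]).
  exact (smooth_pd 3 h ltac:(lia) H).
Qed.

Definition spd (j : nat) (h : SF) : SF := mkSF _ (smooth_pd_all j h (sf_smooth h)).

Definition rmul (j : nat) (a : quat) : SF :=
  (coord j (qmul (basis4 0) a) *: scoord 0 + coord j (qmul (basis4 1) a) *: scoord 1
   + coord j (qmul (basis4 2) a) *: scoord 2 + coord j (qmul (basis4 3) a) *: scoord 3)%sf.

Lemma rmulE j a g : rmul j a g = coord j (qmul g a).
Proof. destruct j as [|[|[|j]]]; simpl; ring. Qed.

(* The left-invariant vector field [g |-> g a], as a derivation. *)
Definition E (a : quat) (h : SF) : SF :=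
  (rmul 0 a * spd 0 h + rmul 1 a * spd 1 h + rmul 2 a * spd 2 h + rmul 3 a * spd 3 h)%sf.

Lemma E_val a h g :
  E a h g = q0 (qmul g a) * pd 0 h g + q1 (qmul g a) * pd 1 h g
          + q2 (qmul g a) * pd 2 h g + q3 (qmul g a) * pd 3 h g.
Proof.
  transitivity (rmul 0 a g * pd 0 h g + rmul 1 a g * pd 1 h g
          + rmul 2 a g * pd 2 h g + rmul 3 a g * pd 3 h g); [reflexivity|].
  rewrite !rmulE. reflexivity.
Qed.

Lemma pd_add j (h k : SF) x : (j < 4)%nat -> pd j (h + k)%sf x = pd j h x + pd j k x.
Proof.
  intro Hj. apply pd_unique. apply derivable_pt_lim_plus; apply smooth_pd_lim; try apply sf_smooth; lia.
Qed.

Lemma pd_mul j (h k : SF) x : (j < 4)%nat ->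
  pd j (h * k)%sf x = pd j h x * k x + h x * pd j k x.
Proof.
  intro Hj. apply pd_unique.
  pose proof (derivable_pt_lim_mult _ _ _ _ _ (smooth_pd_lim j h x Hj (sf_smooth h))
               (smooth_pd_lim j k x Hj (sf_smooth k))) as M.
  cbv beta in M. rewrite basis_shift0 in M. exact M.
Qed.

Lemma pd_const j c x : pd j (sconst c) x = 0.
Proof. apply pd_unique, derivable_pt_lim_const. Qed.

Lemma E_add a h k : E a (h + k)%sf = (E a h + E a k)%sf.
Proof.
  apply SF_ext; intro g. change ((E a h + E a k)%sf g) with (E a h g + E a k g).
  rewrite !E_val, !pd_add by lia. ring.
Qed.

Lemma E_mul a h k : E a (h * k)%sf = (E a h * k + h * E a k)%sf.
Proof.
  apply SF_ext; intro g.
  change ((E a h * k + h * E a k)%sf g) with (E a h g * k g + h g * E a k g).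
  rewrite !E_val, !pd_mul by lia. ring.
Qed.

Lemma E_const a c : E a (sconst c) = sconst 0.
Proof. apply SF_ext; intro g. rewrite E_val, !pd_const. simpl. ring. Qed.

Lemma E_scal a c h : E a (c *: h)%sf = (c *: E a h)%sf.
Proof.
  unfold sscal at 1. rewrite E_mul, E_const. apply SF_ext; intro g. simpl. ring.
Qed.

Lemma E_lin a b r s h g : E (qadd (qscale r a) (qscale s b)) h g = r * E a h g + s * E b h g.
Proof. rewrite !E_val. simpl. ring. Qed.

Lemma E_lin3 (a : quat) h g : q0 a = 0 ->
  E a h g = q1 a * E (basis4 1) h g + q2 a * E (basis4 2) h g + q3 a * E (basis4 3) h g.
Proof. intro Z. rewrite !E_val. simpl. rewrite Z. ring. Qed.

Lemma E_coord a j g : E a (scoord j) g = coord j (qmul g a).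
Proof.
  assert (P : forall e x, pd e (scoord j) x = coord j (basis4 e)).
  { intros e x. apply pd_unique.
    change (derivable_pt_lim (fun t => coord j (qadd x (qscale t (basis4 e)))) 0 (coord j (basis4 e))).
    replace (fun t => coord j (qadd x (qscale t (basis4 e))))
      with (fun t => coord j x + t * coord j (basis4 e)).
    - apply is_derive_Reals. auto_derive; [exact I|ring].
    - apply functional_extensionality; intro t. destruct j as [|[|[|j']]]; simpl; ring. }
  rewrite E_val, !P. destruct j as [|[|[|j]]]; simpl; ring.
Qed.

Lemma E_rmul a b j g : E a (rmul j b) g = coord j (qmul (qmul g a) b).
Proof.
  unfold rmul. rewrite !E_add, !E_scal.
  transitivity (coord j (qmul (basis4 0) b) * E a (scoord 0) g
    + coord j (qmul (basis4 1) b) * E a (scoord 1) g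
    + coord j (qmul (basis4 2) b) * E a (scoord 2) g
    + coord j (qmul (basis4 3) b) * E a (scoord 3) g); [reflexivity|].
  rewrite !E_coord. destruct j as [|[|[|j]]]; simpl; ring.
Qed.

Definition qbracket (a b : quat) : quat := qadd (qmul a b) (qscale (-1) (qmul b a)).

(** Differentiating the coefficient [g b] along [g a] gives [g a b]; the second-order parts agree by
    symmetry of the partial derivatives, so only the quaternion commutator survives. *)
Lemma E_comm a b h g : E a (E b h) g = E b (E a h) g + E (qbracket a b) h g.
Proof.
  assert (X : forall a b, E a (E b h) g =
    (q0 (qmul (qmul g a) b) * pd 0 h g + q1 (qmul (qmul g a) b) * pd 1 h g
    + q2 (qmul (qmul g a) b) * pd 2 h g + q3 (qmul (qmul g a) b) * pd 3 h g)
    + (q0 (qmul g b) * E a (spd 0 h) g + q1 (qmul g b) * E a (spd 1 h) g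
    + q2 (qmul g b) * E a (spd 2 h) g + q3 (qmul g b) * E a (spd 3 h) g)).
  { clear a b. intros a b. unfold E at 2. rewrite !E_add, !E_mul.
    transitivity (
      (E a (rmul 0 b) g * pd 0 h g + rmul 0 b g * E a (spd 0 h) g)
      + (E a (rmul 1 b) g * pd 1 h g + rmul 1 b g * E a (spd 1 h) g)
      + (E a (rmul 2 b) g * pd 2 h g + rmul 2 b g * E a (spd 2 h) g)
      + (E a (rmul 3 b) g * pd 3 h g + rmul 3 b g * E a (spd 3 h) g)); [reflexivity|].
    rewrite !E_rmul, !rmulE. unfold coord. ring. }
  rewrite !X, !E_val.
  assert (S : forall i j, (i < 4)%nat -> (j < 4)%nat -> pd i (spd j h) g = pd j (spd i h) g).
  { intros i j Hi Hj. apply (pd_comm i j h g Hi Hj (sf_smooth h)). }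
  rewrite (S 1%nat 0%nat), (S 2%nat 0%nat), (S 3%nat 0%nat), (S 2%nat 1%nat), (S 3%nat 1%nat),
    (S 3%nat 2%nat) by lia.
  unfold qbracket. simpl. ring.
Qed.

(** The straight line leaves the sphere, but it is the curve that [dirderiv] uses. *)
Lemma E_line a (h : SF) g :
  derivable_pt_lim (fun t => h (qadd g (qscale t (qmul g a)))) 0 (E a h g).
Proof.
  pose proof (chain_rule h (fun t => qadd g (qscale t (qmul g a))) 0 (qmul g a) (sf_smooth h)) as C.
  cbv beta in C.
  replace (qadd g (qscale 0 (qmul g a))) with g in C by (apply quat_ext; simpl; ring).
  rewrite E_val.
  match type of C with _ -> _ -> _ -> _ -> derivable_pt_lim _ _ ?l =>
    match goal with |- derivable_pt_lim _ _ ?m => replace m with l by ring end end.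
  apply C; apply is_derive_Reals; simpl; auto_derive; trivial; ring.
Qed.

(** * Great circles as integral curves of left-invariant fields *)

Definition im_unit (a : quat) : Prop := q0 a = 0 /\ qdot a a = 1.

(** For an imaginary unit [a] this is [g exp(t a)], the integral curve of [E a] through [g]; unlike
    the straight line it stays on the sphere. *)
Definition geo (g a : quat) (t : R) : quat := qmul g (qadd (qreal (cos t)) (qscale (sin t) a)).

Lemma geo0 g a : geo g a 0 = g.
Proof. unfold geo. rewrite cos_0, sin_0. apply quat_ext; simpl; ring. Qed.

Lemma qdot_qmul p q : qdot (qmul p q) (qmul p q) = qdot p p * qdot q q.
Proof. unfold qdot; simpl; ring. Qed.

Lemma geo_onS3 g a t : im_unit a -> onS3 g -> onS3 (geo g a t).
Proof.
  intros [Za Na] Hg. apply onS3_sq. apply onS3_sq in Hg. unfold geo.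
  rewrite qdot_qmul, Hg. pose proof (sin2_cos2 t) as P. unfold Rsqr in P.
  unfold qdot in *. simpl. rewrite Za in *. nra.
Qed.

Lemma E_geo (h : SF) g a t : im_unit a ->
  derivable_pt_lim (fun s => h (geo g a s)) t (E a h (geo g a t)).
Proof.
  intros [Za Na].
  set (c' := qmul g (qadd (qreal (- sin t)) (qscale (cos t) a))).
  assert (Hc : qmul (geo g a t) a = c').
  { unfold qdot in Na. rewrite Za in Na.
    assert (A1 : q1 a * q1 a = 1 - q2 a * q2 a - q3 a * q3 a) by lra.
    unfold c', geo. apply quat_ext; simpl; rewrite Za; ring [A1]. }
  pose proof (chain_rule h (geo g a) t c' (sf_smooth h)) as C.
  rewrite E_val, Hc.
  match type of C with _ -> _ -> _ -> _ -> derivable_pt_lim _ _ ?l =>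
    match goal with |- derivable_pt_lim _ _ ?m => replace m with l by ring end end.
  apply C; apply is_derive_Reals; unfold geo; simpl; auto_derive; trivial; ring.
Qed.

(** Great circles stay on the sphere, so an identity known only there may be differentiated. This is
    how all later relations are prolonged. *)
Lemma E_vanish (h : SF) g a : im_unit a -> (forall g, onS3 g -> h g = 0) -> onS3 g -> E a h g = 0.
Proof.
  intros Ha H Hg. pose proof (E_geo h g a 0 Ha) as D. rewrite geo0 in D.
  apply is_derive_Reals, is_derive_unique in D. rewrite <- D.
  rewrite (Derive_ext _ (fun _ => 0)); [apply Derive_const|].
  intro t. apply H, geo_onS3; assumption.
Qed.

Lemma S3_polar g : onS3 g -> exists a t, im_unit a /\ geo (qreal 1) a t = g.
Proof.
  intro Hg. apply onS3_sq in Hg. unfold qdot in Hg.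
  assert (B : -1 <= q0 g <= 1) by (split; nra).
  set (m := q1 g * q1 g + q2 g * q2 g + q3 g * q3 g).
  assert (Hs : sin (acos (q0 g)) = sqrt m).
  { rewrite sin_acos by exact B. f_equal. unfold m, Rsqr. lra. }
  assert (Hm : 0 <= m) by (unfold m; nra).
  destruct (Req_dec m 0) as [M0|M0].
  (* At [1] and [-1] every direction serves; [i] is chosen. *)
  - exists (mkQ 0 1 0 0), (acos (q0 g)).
    assert (q1 g = 0 /\ q2 g = 0 /\ q3 g = 0) as [Z1 [Z2 Z3]] by (unfold m in M0; repeat split; nra).
    split; [unfold im_unit, qdot; simpl; split; ring|].
    unfold geo. rewrite cos_acos, Hs, M0, sqrt_0 by exact B.
    apply quat_ext; simpl; rewrite ?Z1, ?Z2, ?Z3; ring.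
  - assert (Hp : 0 < sqrt m) by (apply sqrt_lt_R0; lra).
    pose proof (sqrt_sqrt m Hm) as SS.
    exists (mkQ 0 (q1 g / sqrt m) (q2 g / sqrt m) (q3 g / sqrt m)), (acos (q0 g)).
    split.
    + split; [reflexivity|]. unfold qdot; simpl.
      transitivity ((q1 g * q1 g + q2 g * q2 g + q3 g * q3 g) / (sqrt m * sqrt m)); [field; lra|].
      rewrite SS. fold m. field. lra.
    + unfold geo. rewrite cos_acos, Hs by exact B.
      apply quat_ext; simpl; field; lra.
Qed.

(** Every point lies on a great circle through [1], along which the derivative of [h] vanishes. *)
Lemma S3_constant (h : SF) :
  (forall g, onS3 g -> E (basis4 1) h g = 0 /\ E (basis4 2) h g = 0 /\ E (basis4 3) h g = 0) ->
  forall g, onS3 g -> h g = h (qreal 1).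
Proof.
  intros H g Hg. destruct (S3_polar g Hg) as [a [t [Ha Eg]]].
  assert (H1 : onS3 (qreal 1)) by (apply onS3_sq; unfold qdot; simpl; ring).
  assert (D : forall s, is_derive (fun s => h (geo (qreal 1) a s)) s 0).
  { intro s. pose proof (geo_onS3 _ a s Ha H1) as Hs. destruct (H _ Hs) as [A1 [A2 A3]].
    apply is_derive_Reals. replace 0 with (E a h (geo (qreal 1) a s)); [apply E_geo, Ha|].
    rewrite E_lin3 by apply Ha. rewrite A1, A2, A3. ring. }
  rewrite <- Eg. rewrite <- (geo0 (qreal 1) a) at 2.
  destruct (MVT_gen (fun s => h (geo (qreal 1) a s)) 0 t (fun _ => 0)) as [c [_ Hc]].
  - intros s _. apply D.
  - intros s _. apply derivable_continuous_pt. eexists. apply is_derive_Reals, D.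
  - cbv beta in Hc. lra.
Qed.

(** * Maxima on the sphere and the second-order test at them *)

Definition tn4 (x : quat) : Compactness.Tn 4 R := (q0 x, (q1 x, (q2 x, (q3 x, tt)))).

(** Without a maximum, every point of the sphere has a box on which [h] stays below its value at
    some chosen point of the sphere. Finitely many boxes cover the cube [[-1, 1]^4], and the best of
    their chosen points gives a contradiction. *)
Lemma S3_max (h : quat -> R) : cont_on_R4 h ->
  exists g0, onS3 g0 /\ forall g, onS3 g -> h g <= h g0.
Proof.
  intro Hc. apply NNPP. intro N.
  assert (Y : forall x, onS3 x -> exists y, onS3 y /\ h x < h y).
  { intros x Hx. apply NNPP. intro M. apply N. exists x. split; [exact Hx|].
    intros g Hg. apply Rnot_lt_le. intro L. apply M. exists g. tauto. }
  assert (C : cont_on_R4 (fun x => qdot x x)).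
  { unfold qdot. repeat apply cont_add; apply cont_mul;
    first [exact (cont_coord 0)|exact (cont_coord 1)|exact (cont_coord 2)|exact (cont_coord 3)]. }
  assert (Z : forall x, exists p : posreal * quat, onS3 (snd p) /\
             forall y, close (fst p) x y -> onS3 y -> h y < h (snd p)).
  { intro x. destruct (classic (onS3 x)) as [Hx|Hx].
    - destruct (Y x Hx) as [y [Hy L]].
      destruct (cont_close h x (h y - h x) Hc ltac:(lra)) as [d [Hd D]].
      exists (mkposreal d Hd, y). split; [exact Hy|]. intros z Hz _. simpl in *.
      specialize (D z Hz). apply Rabs_def2 in D. lra.
    (* Off the sphere the box is made to miss the sphere, so its condition is vacuous and the
       attached point [qreal 1] is arbitrary. *)
    - assert (Hp : 0 < Rabs (qdot x x - 1)).
      { apply Rabs_pos_lt. intro K. apply Hx, onS3_sq. lra. }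
      destruct (cont_close _ x _ C Hp) as [d [Hd D]].
      exists (mkposreal d Hd, qreal 1).
      split; [apply onS3_sq; unfold qdot; simpl; ring|]. intros z Hz Sz. exfalso.
      specialize (D z Hz). apply onS3_sq in Sz. cbv beta in D. rewrite Sz in D.
      rewrite <- Rabs_Ropp in D. replace (- (1 - qdot x x)) with (qdot x x - 1) in D by ring. lra. }
  pose (F := fun x => proj1_sig (constructive_indefinite_description _ (Z x))).
  assert (HF : forall x, onS3 (snd (F x)) /\
            forall y, close (fst (F x)) x y -> onS3 y -> h y < h (snd (F x))).
  { intro x. unfold F. apply proj2_sig. }
  clearbody F.
  set (q := fun t : Compactness.Tn 4 R => let '(a, (b, (c, (d, _)))) := t in mkQ a b c d).
  apply (compactness_list 4 (tn4 (mkQ (-1) (-1) (-1) (-1))) (tn4 (mkQ 1 1 1 1))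
           (fun t => fst (F (q t)))).
  intros [l Hl].
  assert (Max : l <> nil -> exists t, In t l /\
             forall s, In s l -> h (snd (F (q s))) <= h (snd (F (q t)))).
  { clear. induction l as [|a l IH]; [easy|]. intros _.
    destruct l as [|b l].
    - exists a. split; [now left|]. intros s [<-|[]]. lra.
    - destruct IH as [t [Ht Mt]]; [easy|].
      destruct (Rle_dec (h (snd (F (q a)))) (h (snd (F (q t))))) as [L|L].
      + exists t. split; [now right|]. intros s [<-|Hs]; [exact L|auto].
      + exists a. split; [now left|]. intros s [<-|Hs]; [lra|]. specialize (Mt s Hs). lra. }
  assert (Cov : forall y, onS3 y -> exists t, In t l /\ h y < h (snd (F (q t)))).
  { intros y Hy. destruct (Hl (tn4 y)) as [t [Ht [_ Ct]]].
    - apply onS3_sq in Hy. unfold qdot in Hy. simpl. repeat split; nra.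
    - exists t. split; [exact Ht|]. apply (proj2 (HF (q t))); [|exact Hy].
      destruct t as [a [b [c [d []]]]]. simpl in Ct. simpl.
      apply close_intro; simpl; tauto. }
  assert (H1 : onS3 (qreal 1)) by (apply onS3_sq; unfold qdot; simpl; ring).
  destruct Max as [t [Ht Mt]].
  { intro K. destruct (Cov _ H1) as [t [Ht _]]. rewrite K in Ht. destruct Ht. }
  (* The best chosen point lies in some box of the cover, hence is beaten by another chosen
     point. *)
  destruct (Cov (snd (F (q t))) (proj1 (HF (q t)))) as [s [Hs Ls]].
  specialize (Mt s Hs). lra.
Qed.

(** If [l > 0], then [u'] is positive just to the right of [0], and the mean value theorem gives a
    value above [u 0]. *)
Lemma second_derivative_test (u u' : R -> R) (l : R) :
  (forall t, derivable_pt_lim u t (u' t)) -> derivable_pt_lim u' 0 l ->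
  (forall t, u t <= u 0) -> u' 0 = 0 /\ l <= 0.
Proof.
  intros D D2 M.
  assert (Z : u' 0 = 0).
  { set (pr := (exist _ (u' 0) (D 0) : derivable_pt u 0)).
    change (derive_pt u 0 pr = 0).
    apply (deriv_maximum u (-1) 1); try lra. intros; apply M. }
  split; [exact Z|]. apply Rnot_lt_le. intro L.
  destruct (D2 (l / 2) ltac:(lra)) as [d Hd].
  pose proof (cond_pos d) as Pd.
  destruct (MVT_cor2 u u' 0 (d / 2)) as [c [Ec Hc]]; [lra|intros; apply D|].
  specialize (Hd c ltac:(lra)). rewrite Rabs_pos_eq, Rplus_0_l, Z in Hd by lra.
  specialize (Hd ltac:(lra)). apply Rabs_def2 in Hd.
  specialize (M (d / 2)).
  assert (0 < u' c).
  { replace (u' c) with ((u' c - 0) / c * c) by (field; lra).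
    apply Rmult_lt_0_compat; lra. }
  nra.
Qed.

Lemma S3_max_test (h : SF) g0 a : im_unit a -> onS3 g0 ->
  (forall g, onS3 g -> h g <= h g0) -> E a h g0 = 0 /\ E a (E a h) g0 <= 0.
Proof.
  intros Ha Hg M.
  pose proof (second_derivative_test (fun t => h (geo g0 a t)) (fun t => E a h (geo g0 a t))
               (E a (E a h) g0)) as T.
  cbv beta in T. rewrite geo0 in T. apply T.
  - intro t. apply E_geo, Ha.
  - pose proof (E_geo (E a h) g0 a 0 Ha) as D. rewrite geo0 in D. exact D.
  - intro t. apply M, geo_onS3; assumption.
Qed.

(** * Jets in an adapted frame *)

Lemma ev_add (h k : SF) g : (h + k)%sf g = h g + k g.
Proof. reflexivity. Qed.
Lemma ev_mul (h k : SF) g : (h * k)%sf g = h g * k g.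
Proof. reflexivity. Qed.
Lemma ev_scal c (h : SF) g : (c *: h)%sf g = c * h g.
Proof. reflexivity. Qed.
Lemma ev_const c g : sconst c g = c.
Proof. reflexivity. Qed.

Ltac ev_in H := repeat (progress rewrite ?ev_add, ?ev_mul, ?ev_scal, ?ev_const in H).
Ltac ev_goal := repeat (progress rewrite ?ev_add, ?ev_mul, ?ev_scal, ?ev_const).
Ltac jet H := repeat (progress rewrite ?E_add, ?E_mul, ?E_scal, ?E_const in H); ev_in H.
Ltac jetg := repeat (progress rewrite ?E_add, ?E_mul, ?E_scal, ?E_const); ev_goal.

Lemma E_locally_const (h : SF) c a g : im_unit a ->
  (forall g, onS3 g -> h g = c) -> onS3 g -> E a h g = 0.
Proof.
  intros Ha H Hg.
  assert (K : E a (h - sconst c)%sf g = 0).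
  { apply E_vanish; [exact Ha| |exact Hg]. intros k Hk.
    rewrite ev_add, ev_scal, ev_const, H by exact Hk. ring. }
  jet K. lra.
Qed.

(** For orthogonal imaginary [a] and [b] the product is the cross product, so this is a positively
    oriented orthonormal basis of the imaginary quaternions. *)
Definition frame (a b c : quat) : Prop :=
  im_unit a /\ im_unit b /\ qdot a b = 0 /\ c = qmul a b.

Lemma frame_third a b c : frame a b c -> im_unit c.
Proof.
  intros [[Za Na] [[Zb Nb] [O ->]]]. split.
  - unfold qdot in O. simpl. rewrite Za, Zb in *. lra.
  - rewrite qdot_qmul, Na, Nb. ring.
Qed.

Lemma frame_rot a b c : frame a b c -> frame b c a.
Proof.
  intro Fr. pose proof (frame_third _ _ _ Fr) as Hc.
  destruct Fr as [[Za Na] [Hb [O Ec]]]. split; [exact Hb|]. destruct Hb as [Zb Nb].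
  unfold qdot in Nb, O. rewrite Za, Zb in *.
  split; [exact Hc|]. subst c. split.
  - unfold qdot. simpl. rewrite Za, Zb. ring.
  (* The coordinates of [b a b = |b|^2 a - 2 <a, b> b], valid for imaginary [a] and [b]. *)
  - assert (K : forall u v, u = u * (0 * 0 + q1 b * q1 b + q2 b * q2 b + q3 b * q3 b)
                 - 2 * v * (0 * 0 + q1 a * q1 b + q2 a * q2 b + q3 a * q3 b))
      by (intros; rewrite Nb, O; ring).
    apply quat_ext; simpl; rewrite Za, Zb; [ring|..].
    + rewrite (K (q1 a) (q1 b)) at 1. ring.
    + rewrite (K (q2 a) (q2 b)) at 1. ring.
    + rewrite (K (q3 a) (q3 b)) at 1. ring.
Qed.

Lemma frame_bracket a b c : frame a b c -> qbracket a b = qscale 2 c.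
Proof.
  intros [[Za Na] [[Zb Nb] [O Ec]]]. subst c. unfold qbracket.
  unfold qdot in O. rewrite Za, Zb in O.
  apply quat_ext; simpl; rewrite Za, Zb; lra.
Qed.

Lemma E_frame_comm a b c h : frame a b c -> E a (E b h) = (E b (E a h) + 2 *: E c h)%sf.
Proof.
  intro Fr. apply SF_ext; intro g. rewrite E_comm, (frame_bracket _ _ _ Fr), ev_add, ev_scal.
  f_equal. rewrite !E_val. simpl. ring.
Qed.

(* The matrix Riccati equation [r p' = - p^2 + 2 r (z, t; -x, -y)] of [p = (x, y; z, t)] is
   incompatible with two derivatives of the constraint [alpha (y - z) + r (x + t) = 0]. *)
Lemma riccati_rigidity (r alpha x y z t X Y Z T : R) :
  0 < r -> alpha <> 0 ->
  alpha * (y - z) + r * (x + t) = 0 ->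
  r * X = - (x * x + y * z) + 2 * r * z ->
  r * Y = - (x * y + y * t) + 2 * r * t ->
  r * Z = - (z * x + t * z) - 2 * r * x ->
  r * T = - (y * z + t * t) - 2 * r * y ->
  alpha * (Y - Z) + r * (X + T) = 0 ->
  alpha * (- (X * y + x * Y + Y * t + y * T) + (Z * x + z * X + T * z + t * Z) + 2 * r * (X + T))
  - r * (2 * (x * X + Y * z + y * Z + t * T) + 2 * r * (Y - Z)) = 0 ->
  x = 0 /\ y = 0 /\ z = 0 /\ t = 0.
Proof.
  intros Hr Ha C HX HY HZ HT S S'.
  set (k := alpha / r). assert (Hk : alpha = k * r) by (unfold k; field; lra).
  assert (Hk0 : k <> 0) by (intro K; apply Ha; rewrite Hk, K; ring).
  rewrite Hk in *. clearbody k. clear Hk Ha.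
  (* [c] measures the asymmetry of [p], and [Tr] is the trace of [p^2]. *)
  set (c := y - z) in *. set (Tr := x * x + 2 * y * z + t * t).
  assert (D : x + t = - k * c) by (apply Rmult_eq_reg_l with r; lra).
  assert (A : r * (X + T) = - Tr - 2 * r * c) by (unfold Tr, c; lra).
  assert (B : r * (Y - Z) = - c * (x + t) + 2 * r * (x + t)) by (unfold c; lra).
  assert (G : r * (x * X + Y * z + y * Z + t * T)
              = - (3 * (x + t) * Tr - (x + t) * (x + t) * (x + t)) / 2 - 2 * r * c * (x + t)).
  { transitivity (x * (r * X) + z * (r * Y) + y * (r * Z) + t * (r * T)); [ring|].
    rewrite HX, HY, HZ, HT. unfold Tr, c. field. }
  assert (S1 : k * (r * (Y - Z)) + r * (X + T) = 0) by lra.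
  assert (S2 : k * (- (r * (X + T)) * c - (x + t) * (r * (Y - Z)) + 2 * r * (r * (X + T)))
               - 2 * (r * (x * X + Y * z + y * Z + t * T)) - 2 * r * (r * (Y - Z)) = 0).
  { transitivity (k * r * (- (X * y + x * Y + Y * t + y * T) + (Z * x + z * X + T * z + t * Z)
       + 2 * r * (X + T)) - r * (2 * (x * X + Y * z + y * Z + t * T) + 2 * r * (Y - Z))).
    - unfold c. ring.
    - exact S'. }
  rewrite A, B, D in S1. rewrite A, B, G, D in S2.
  assert (HTr : Tr = k * k * c * c - 2 * r * k * k * c - 2 * r * c) by lra.
  (* Once [Tr] is expressed by [c], the second derivative of the constraint loses all powers of [c]
     except the first. *)
  assert (K : (4 * (r * r) * (1 + k * k) * k) * c = 0).
  { rewrite HTr in S2. rewrite <- S2. field. }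
  assert (c0 : c = 0).
  { apply Rmult_integral in K. destruct K as [K|K]; [|exact K].
    exfalso. apply Rmult_integral in K. destruct K as [K|K]; [nra|contradiction]. }
  rewrite c0 in *. assert (y = z) by (unfold c in c0; lra). assert (t = - x) by lra. subst y t.
  (* Now [p] is symmetric and trace-free, so [Tr = 0] reads [2 x^2 + 2 z^2 = 0]. *)
  unfold Tr in HTr. assert (x = 0) by nra. assert (z = 0) by nra. subst. repeat split; ring.
Qed.

(** * The first-order system for the components of the field in a left-invariant frame *)

Section Jets.

Variables (a b c : quat) (F1 F2 F3 : SF) (r alpha : R).
Hypothesis Fr : frame a b c.

Local Notation E1 := (E a).
Local Notation E2 := (E b).
Local Notation E3 := (E c).

Definition fdiv : SF := (E1 F1 + E2 F2 + E3 F3)%sf.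
(** Only derivatives of components enter: the Levi-Civita curl of the field is this curl minus twice
    the field. *)
Definition fcurl1 : SF := (E2 F3 - E3 F2)%sf.
Definition fcurl2 : SF := (E3 F1 - E1 F3)%sf.
Definition fcurl3 : SF := (E1 F2 - E2 F1)%sf.
Definition helicity : SF := (F1 * fcurl1 + F2 * fcurl2 + F3 * fcurl3)%sf.
Definition fsq : SF := (F1 * F1 + F2 * F2 + F3 * F3)%sf.
Definition DF (h : SF) : SF := (F1 * E1 h + F2 * E2 h + F3 * E3 h)%sf.

Hypothesis Hsq : forall g, onS3 g -> fsq g = r * r.
Hypothesis HDF1 : forall g, onS3 g -> DF F1 g = 0.
Hypothesis HDF2 : forall g, onS3 g -> DF F2 g = 0.
Hypothesis HDF3 : forall g, onS3 g -> DF F3 g = 0.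
Hypothesis Hcurl1 : forall g, onS3 g -> alpha * fcurl1 g + F1 g * fdiv g = 0.
Hypothesis Hcurl2 : forall g, onS3 g -> alpha * fcurl2 g + F2 g * fdiv g = 0.
Hypothesis Hcurl3 : forall g, onS3 g -> alpha * fcurl3 g + F3 g * fdiv g = 0.

Let Ha : im_unit a := proj1 Fr.
Let Hb : im_unit b := proj1 (proj2 Fr).
Let Hc : im_unit c := frame_third a b c Fr.

Lemma comm12 h : E1 (E2 h) = (E2 (E1 h) + 2 *: E3 h)%sf.
Proof. apply E_frame_comm, Fr. Qed.
Lemma comm23 h : E2 (E3 h) = (E3 (E2 h) + 2 *: E1 h)%sf.
Proof. apply E_frame_comm, frame_rot, Fr. Qed.
Lemma comm31 h : E3 (E1 h) = (E1 (E3 h) + 2 *: E2 h)%sf.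
Proof. apply E_frame_comm, frame_rot, frame_rot, Fr. Qed.

Lemma E_sq (d : quat) g : im_unit d -> onS3 g ->
  F1 g * E d F1 g + F2 g * E d F2 g + F3 g * E d F3 g = 0.
Proof.
  intros Hd Hg. pose proof (E_locally_const fsq _ d g Hd Hsq Hg) as K.
  unfold fsq in K. jet K. lra.
Qed.

(* [W1 G], [W2 G], [W3 G] are what [DF (E1 G)], [DF (E2 G)], [DF (E3 G)] become on the sphere
   when [DF G = 0] there: no second derivative is left. *)
Definition W1 (G : SF) : SF :=
  ((-1) *: (E1 F1 * E1 G + E1 F2 * E2 G + E1 F3 * E3 G)
   + 2 *: (F3 * E2 G - F2 * E3 G))%sf.
Definition W2 (G : SF) : SF :=
  ((-1) *: (E2 F1 * E1 G + E2 F2 * E2 G + E2 F3 * E3 G)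
   + 2 *: (F1 * E3 G - F3 * E1 G))%sf.
Definition W3 (G : SF) : SF :=
  ((-1) *: (E3 F1 * E1 G + E3 F2 * E2 G + E3 F3 * E3 G)
   + 2 *: (F2 * E1 G - F1 * E2 G))%sf.

(** Differentiate [DF G = 0] along [a]. Moving [E1] inside the second derivatives yields
    [DF (E1 G)], and the commutators supply the terms with coefficient 2. *)
Lemma DF_E1 G : (forall g, onS3 g -> DF G g = 0) -> forall g, onS3 g -> DF (E1 G) g = W1 G g.
Proof.
  intros H g Hg. pose proof (E_vanish _ g a Ha H Hg) as K. unfold DF in K. jet K.
  rewrite comm12 in K.
  pose proof (f_equal (fun h => sf h g) (comm31 G)) as L. cbv beta in L. ev_in L. ev_in K.
  unfold DF, W1. ev_goal. rewrite L. lra.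
Qed.

Lemma DF_E2 G : (forall g, onS3 g -> DF G g = 0) -> forall g, onS3 g -> DF (E2 G) g = W2 G g.
Proof.
  intros H g Hg. pose proof (E_vanish _ g b Hb H Hg) as K. unfold DF in K. jet K.
  pose proof (f_equal (fun h => sf h g) (comm12 G)) as L.
  pose proof (f_equal (fun h => sf h g) (comm23 G)) as M. cbv beta in L, M. ev_in L. ev_in M.
  unfold DF, W2. ev_goal.
  rewrite L. rewrite M in K. lra.
Qed.

Lemma DF_E3 G : (forall g, onS3 g -> DF G g = 0) -> forall g, onS3 g -> DF (E3 G) g = W3 G g.
Proof.
  intros H g Hg. pose proof (E_vanish _ g c Hc H Hg) as K. unfold DF in K. jet K.
  pose proof (f_equal (fun h => sf h g) (comm31 G)) as L.
  pose proof (f_equal (fun h => sf h g) (comm23 G)) as M. cbv beta in L, M. ev_in L. ev_in M.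
  unfold DF, W3. ev_goal.
  rewrite L in K. rewrite M. lra.
Qed.

Lemma alpha_helicity g : onS3 g -> alpha * helicity g + r * r * fdiv g = 0.
Proof.
  intro Hg. rewrite <- (Hsq g Hg). unfold helicity, fsq. rewrite !ev_add, !ev_mul.
  pose proof (Hcurl1 g Hg) as A1; pose proof (Hcurl2 g Hg) as A2; pose proof (Hcurl3 g Hg) as A3.
  transitivity (F1 g * (alpha * fcurl1 g + F1 g * fdiv g) + F2 g * (alpha * fcurl2 g + F2 g * fdiv g)
    + F3 g * (alpha * fcurl3 g + F3 g * fdiv g)); [ring|]. rewrite A1, A2, A3. ring.
Qed.

Definition Wdiv : SF := (W1 F1 + W2 F2 + W3 F3)%sf.
Definition Whel : SF :=
  (F1 * (W2 F3 - W3 F2) + F2 * (W3 F1 - W1 F3) + F3 * (W1 F2 - W2 F1))%sf.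

Lemma DF_div g : onS3 g -> DF fdiv g = Wdiv g.
Proof.
  intro Hg. unfold Wdiv. rewrite !ev_add.
  rewrite <- (DF_E1 F1 HDF1 g Hg), <- (DF_E2 F2 HDF2 g Hg), <- (DF_E3 F3 HDF3 g Hg).
  unfold DF, fdiv. jetg. ring.
Qed.

Lemma DF_helicity g : onS3 g -> DF helicity g = Whel g.
Proof.
  intro Hg. unfold Whel. ev_goal.
  rewrite <- (DF_E2 F3 HDF3 g Hg), <- (DF_E3 F2 HDF2 g Hg), <- (DF_E3 F1 HDF1 g Hg),
    <- (DF_E1 F3 HDF3 g Hg), <- (DF_E1 F2 HDF2 g Hg), <- (DF_E2 F1 HDF1 g Hg).
  pose proof (HDF1 g Hg) as A1; pose proof (HDF2 g Hg) as A2; pose proof (HDF3 g Hg) as A3.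
  transitivity (DF F1 g * fcurl1 g + DF F2 g * fcurl2 g + DF F3 g * fcurl3 g
    + F1 g * (DF (E2 F3) g - DF (E3 F2) g) + F2 g * (DF (E3 F1) g - DF (E1 F3) g)
    + F3 g * (DF (E1 F2) g - DF (E2 F1) g)).
  - unfold DF, helicity, fcurl1, fcurl2, fcurl3. jetg. ring.
  - rewrite A1, A2, A3. ring.
Qed.

(** The derivative of [alpha_helicity] along the field, rewritten with first derivatives only, so
    that it can be differentiated once more. *)
Lemma alpha_W g : onS3 g -> (alpha *: Whel + (r * r) *: Wdiv)%sf g = 0.
Proof.
  intro Hg. rewrite ev_add, !ev_scal, <- DF_helicity, <- DF_div by exact Hg.
  assert (Z : forall g, onS3 g -> (alpha *: helicity + (r * r) *: fdiv)%sf g = 0)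
    by (intros k Hk; apply alpha_helicity, Hk).
  pose proof (E_vanish _ g a Ha Z Hg) as Z1. pose proof (E_vanish _ g b Hb Z Hg) as Z2.
  pose proof (E_vanish _ g c Hc Z Hg) as Z3. rewrite E_add, !E_scal, ev_add, !ev_scal in Z1, Z2, Z3.
  unfold DF. rewrite ?ev_add, ?ev_mul.
  transitivity (F1 g * (alpha * E1 helicity g + r * r * E1 fdiv g)
   + F2 g * (alpha * E2 helicity g + r * r * E2 fdiv g)
   + F3 g * (alpha * E3 helicity g + r * r * E3 fdiv g)); [ring|]. rewrite Z1, Z2, Z3. ring.
Qed.

(** * Relations at a point where the field is [r] times the first frame vector *)

Section Adapted.

Variable g : quat.
Hypothesis Hg : onS3 g.
Hypothesis Hr : 0 < r.
Hypothesis V1 : F1 g = r.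
Hypothesis V2 : F2 g = 0.
Hypothesis V3 : F3 g = 0.

(** The field has constant length, so its derivative is orthogonal to it. *)
Lemma jet_first (d : quat) : im_unit d -> E d F1 g = 0.
Proof. intro Hd. pose proof (E_sq d g Hd Hg) as K. rewrite V1, V2, V3 in K. nra. Qed.

Lemma jet_along G : (forall g, onS3 g -> DF G g = 0) -> E1 G g = 0.
Proof.
  intro H. pose proof (H g Hg) as K. unfold DF in K. ev_in K. rewrite V1, V2, V3 in K. nra.
Qed.

Lemma DF_adapted h : DF h g = r * E1 h g.
Proof. unfold DF. rewrite !ev_add, !ev_mul, V1, V2, V3. ring. Qed.

(** The relations [Q22] to [Q33] are the Riccati equation for the transverse derivative; [S] and
    [S'] are the first and second derivatives of the scalar constraint. *)
Lemma jet_zero_of_alpha : alpha <> 0 ->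
  E2 F2 g = 0 /\ E2 F3 g = 0 /\ E3 F2 g = 0 /\ E3 F3 g = 0.
Proof.
  intro Hal.
  pose proof (jet_first a Ha) as P11; pose proof (jet_first b Hb) as P21;
  pose proof (jet_first c Hc) as P31.
  pose proof (jet_along F2 HDF2) as P12; pose proof (jet_along F3 HDF3) as P13.
  pose proof (Hcurl1 g Hg) as C. unfold fcurl1, fdiv in C. ev_in C. rewrite V1, P11 in C.
  pose proof (alpha_W g Hg) as S.
  pose proof (E_vanish _ g a Ha alpha_W Hg) as S'.
  pose proof (DF_E2 F2 HDF2 g Hg) as Q22; pose proof (DF_E2 F3 HDF3 g Hg) as Q23.
  pose proof (DF_E3 F2 HDF2 g Hg) as Q32; pose proof (DF_E3 F3 HDF3 g Hg) as Q33.
  rewrite DF_adapted in *.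
  unfold Whel, Wdiv, W1, W2, W3 in *.
  jet S'. ev_in S. ev_in Q22. ev_in Q23. ev_in Q32. ev_in Q33.
  rewrite ?V1, ?V2, ?V3, ?P11, ?P21, ?P31, ?P12, ?P13 in *.
  apply (riccati_rigidity r alpha _ _ _ _ (E1 (E2 F2) g) (E1 (E2 F3) g) (E1 (E3 F2) g)
           (E1 (E3 F3) g)); try assumption; try lra.
  (* [alpha_W] is [r * r] times this goal, since [W2 F3] stands for [r * E1 (E2 F3)] there, and
     likewise for the others. *)
  - apply Rmult_eq_reg_l with (r * r); [|nra].
    transitivity (alpha * r * (r * E1 (E2 F3) g - r * E1 (E3 F2) g)
      + r * r * (r * E1 (E2 F2) g + r * E1 (E3 F3) g)); [ring|].
    rewrite Q22, Q23, Q32, Q33. lra.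
  - apply Rmult_eq_reg_l with r; [|lra]. lra.
Qed.

Hypothesis Hal : alpha = 0.
Hypothesis Hr1 : r = 1.

Lemma div_vanish k : onS3 k -> fdiv k = 0.
Proof.
  intro Hk. pose proof (Hsq k Hk) as S. unfold fsq in S. ev_in S. rewrite Hr1 in S.
  pose proof (Hcurl1 k Hk) as A1; pose proof (Hcurl2 k Hk) as A2; pose proof (Hcurl3 k Hk) as A3.
  rewrite Hal in A1, A2, A3.
  transitivity (F1 k * (F1 k * fdiv k) + F2 k * (F2 k * fdiv k) + F3 k * (F3 k * fdiv k)).
  - transitivity ((F1 k * F1 k + F2 k * F2 k + F3 k * F3 k) * fdiv k); [rewrite S|]; ring.
  - replace (F1 k * fdiv k) with 0 by lra. replace (F2 k * fdiv k) with 0 by lra.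
    replace (F3 k * fdiv k) with 0 by lra. ring.
Qed.

(** The derivative of [div_vanish] along the field. It holds on the whole sphere, so it can be
    differentiated across the field as well. *)
Lemma Wdiv_vanish k : onS3 k -> Wdiv k = 0.
Proof.
  intro Hk. rewrite <- DF_div by exact Hk. unfold DF. ev_goal.
  rewrite (E_vanish _ k a Ha div_vanish Hk), (E_vanish _ k b Hb div_vanish Hk),
    (E_vanish _ k c Hc div_vanish Hk). ring.
Qed.

(** With [comm12] and [comm23] this sorts every iterated derivative into the order [E3], [E2], [E1]
    from the outside in; [comm31] would work against that order. *)
Lemma comm13 h : E1 (E3 h) = (E3 (E1 h) + (-2) *: E2 h)%sf.
Proof. rewrite comm31. apply SF_ext; intro k. ev_goal. ring. Qed.

Ltac sort_in H :=
  repeat (progress rewrite ?comm12, ?comm23, ?comm13, ?E_add, ?E_mul, ?E_scal, ?E_const in H);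
  ev_in H.
Ltac sort_goal :=
  repeat (progress rewrite ?comm12, ?comm23, ?comm13, ?E_add, ?E_mul, ?E_scal, ?E_const);
  ev_goal.

(** The last relation is [Wdiv_vanish] at [g], that is, the Monge-Ampere equation
    [(1 + z) (1 - y) - x^2 = 1]. *)
Lemma adapted_relations :
  E3 F3 g = - E2 F2 g /\ helicity g = E2 F3 g - E3 F2 g /\
  E2 F2 g * E2 F2 g = - E2 F3 g * E3 F2 g - E2 F3 g + E3 F2 g.
Proof.
  pose proof (jet_first a Ha) as P11; pose proof (jet_first b Hb) as P21;
  pose proof (jet_first c Hc) as P31.
  pose proof (jet_along F2 HDF2) as P12; pose proof (jet_along F3 HDF3) as P13.
  pose proof (div_vanish g Hg) as D. unfold fdiv in D. ev_in D.
  pose proof (Wdiv_vanish g Hg) as R. unfold Wdiv, W1, W2, W3 in R. ev_in R.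
  assert (D' : E3 F3 g = - E2 F2 g) by lra. split; [exact D'|]. split.
  - unfold helicity, fcurl1, fcurl2, fcurl3. ev_goal. rewrite V1, V2, V3, Hr1. ring.
  - rewrite D', ?V1, ?V2, ?V3, ?P11, ?P21, ?P31, ?P12, ?P13, Hr1 in R. lra.
Qed.

(* The left-hand side is the linearised Monge-Ampere operator, with coefficient matrix
   [(1 + z, -x; -x, 1 - y)]; by [adapted_relations] this matrix has determinant 1, so it is
   definite. Criticality annihilates the second derivatives of [F2] and [F3] across [F], and the
   commutators are all that remains. *)
Lemma critical_hessian :
  E2 helicity g = 0 -> E3 helicity g = 0 ->
  helicity g * helicity g - 4 * helicity g <> 0 ->
  (1 + E3 F2 g) * E2 (E2 helicity) g - 2 * E2 F2 g * E3 (E2 helicity) g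
  + (1 - E2 F3 g) * E3 (E3 helicity) g
  = - 2 * (helicity g * helicity g - 4 * helicity g).
Proof.
  intros K2 K3 Nz. destruct adapted_relations as [P33 [Hh Rel]]. rewrite Hh in Nz |- *. clear Hh.
  pose proof (jet_first a Ha) as P11; pose proof (jet_first b Hb) as P21;
  pose proof (jet_first c Hc) as P31.
  pose proof (jet_along F2 HDF2) as P12; pose proof (jet_along F3 HDF3) as P13.
  pose proof (E_vanish _ g b Hb Wdiv_vanish Hg) as W2'.
  pose proof (E_vanish _ g c Hc Wdiv_vanish Hg) as W3'.
  pose proof (E_vanish _ g b Hb div_vanish Hg) as D2.
  pose proof (E_vanish _ g c Hc div_vanish Hg) as D3.
  pose proof (E_vanish _ g b Hb HDF1 Hg) as Q21.
  pose proof (E_vanish _ g b Hb HDF2 Hg) as Q22.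
  pose proof (E_vanish _ g b Hb HDF3 Hg) as Q23.
  pose proof (E_vanish _ g c Hc HDF1 Hg) as Q31.
  pose proof (E_vanish _ g c Hc HDF2 Hg) as Q32.
  pose proof (E_vanish _ g c Hc HDF3 Hg) as Q33.
  assert (Sb : forall k, onS3 k -> (F1 * E2 F1 + F2 * E2 F2 + F3 * E2 F3)%sf k = 0)
    by (intros k Hk; apply (E_sq b k Hb Hk)).
  assert (Sc : forall k, onS3 k -> (F1 * E3 F1 + F2 * E3 F2 + F3 * E3 F3)%sf k = 0)
    by (intros k Hk; apply (E_sq c k Hc Hk)).
  assert (Sa : forall k, onS3 k -> (F1 * E1 F1 + F2 * E1 F2 + F3 * E1 F3)%sf k = 0)
    by (intros k Hk; apply (E_sq a k Ha Hk)).
  pose proof (E_vanish _ g b Hb Sb Hg) as S22.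
  pose proof (E_vanish _ g c Hc Sb Hg) as S32.
  pose proof (E_vanish _ g c Hc Sc Hg) as S33.
  unfold DF in Q21, Q22, Q23, Q31, Q32, Q33. unfold fdiv in D2, D3.
  unfold Wdiv, W1, W2, W3 in W2', W3'.
  unfold helicity, fcurl1, fcurl2, fcurl3 in K2, K3.
  sort_in Q21. sort_in Q22. sort_in Q23. sort_in Q31. sort_in Q32. sort_in Q33.
  sort_in D2. sort_in D3. sort_in W2'. sort_in W3'. sort_in K2. sort_in K3.
  sort_in S22. sort_in S32. sort_in S33.
  let pt H := (rewrite ?V1, ?V2, ?V3, ?P11, ?P21, ?P31, ?P12, ?P13, ?P33, ?Hr1 in H) in
  pt Q21; pt Q22; pt Q23; pt Q31; pt Q32; pt Q33; pt D2; pt D3; pt W2'; pt W3';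
  pt K2; pt K3; pt S22; pt S32; pt S33.
  set (x := E2 F2 g) in *. set (y := E2 F3 g) in *. set (z := E3 F2 g) in *.
  (* Differentiated across the field, [DF Fi = 0] and the constancy of the length determine the
     second derivatives that involve [E1] or [F1]. *)
  assert (q211 : E2 (E1 F1) g = 0) by lra.
  assert (q212 : E2 (E1 F2) g = y - z) by lra.
  assert (q213 : E2 (E1 F3) g = 0) by lra.
  assert (q311 : E3 (E1 F1) g = 0) by lra.
  assert (q312 : E3 (E1 F2) g = 0) by lra.
  assert (q313 : E3 (E1 F3) g = y - z) by lra.
  assert (q221 : E2 (E2 F1) g = - (x * x + y * y)) by lra.
  assert (q321 : E3 (E2 F1) g = x * (y - z)) by lra.
  assert (q331 : E3 (E3 F1) g = - (x * x + z * z)) by lra.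
  set (A := E2 (E2 F2) g) in *. set (B := E3 (E2 F2) g) in *.
  let pt H := (rewrite ?q211, ?q212, ?q213, ?q311, ?q312, ?q313, ?q221, ?q321, ?q331 in H) in
  pt D2; pt D3; pt W2'; pt W3'; pt K2; pt K3.
  (* Zero divergence and criticality of the helicity leave [A] and [B] as the only unknown second
     derivatives of [F2] and [F3] across the field. *)
  assert (q323 : E3 (E2 F3) g = - A) by lra.
  assert (q333 : E3 (E3 F3) g = - B) by lra.
  assert (q223 : E2 (E2 F3) g = B) by lra.
  assert (q332 : E3 (E3 F2) g = - A) by lra.
  let pt H := (rewrite ?q323, ?q333, ?q223, ?q332 in H) in
  pt W2'; pt W3'.
  (* The Monge-Ampere equation, differentiated once, is a linear system for [A] and [B] with
     determinant [4 x^2 + (y + z)^2], which is [kappa^2 - 4 kappa] and hence non-zero. *)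
  assert (L2 : 2 * x * A + (y + z) * B = 0) by lra.
  assert (L3 : 2 * x * B - (y + z) * A = 0) by lra.
  assert (Nz' : 4 * x * x + (y + z) * (y + z) <> 0) by (intro K; apply Nz; lra).
  assert (HA : A = 0).
  { apply Rmult_eq_reg_l with (4 * x * x + (y + z) * (y + z)); [|exact Nz'].
    transitivity (2 * x * (2 * x * A + (y + z) * B) - (y + z) * (2 * x * B - (y + z) * A));
      [ring|]. rewrite L2, L3. ring. }
  assert (HB : B = 0).
  { apply Rmult_eq_reg_l with (4 * x * x + (y + z) * (y + z)); [|exact Nz'].
    transitivity ((y + z) * (2 * x * A + (y + z) * B) + 2 * x * (2 * x * B - (y + z) * A));
      [ring|]. rewrite L2, L3. ring. }
  clear Q21 Q22 Q23 Q31 Q32 Q33 D2 D3 W2' W3' K2 K3 S22 S32 S33 L2 L3 Nz'.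
  (* Next come the third derivatives: each relation is differentiated a second time across the
     field. *)
  assert (Wb : forall k, onS3 k -> E2 Wdiv k = 0)
    by (intros k Hk; apply (E_vanish _ k b Hb Wdiv_vanish Hk)).
  assert (Wc : forall k, onS3 k -> E3 Wdiv k = 0)
    by (intros k Hk; apply (E_vanish _ k c Hc Wdiv_vanish Hk)).
  assert (Db : forall k, onS3 k -> E2 fdiv k = 0)
    by (intros k Hk; apply (E_vanish _ k b Hb div_vanish Hk)).
  assert (Dc : forall k, onS3 k -> E3 fdiv k = 0)
    by (intros k Hk; apply (E_vanish _ k c Hc div_vanish Hk)).
  assert (Sab : forall k, onS3 k -> E2 (F1 * E1 F1 + F2 * E1 F2 + F3 * E1 F3)%sf k = 0)
    by (intros k Hk; apply (E_vanish _ k b Hb Sa Hk)).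
  assert (Sac : forall k, onS3 k -> E3 (F1 * E1 F1 + F2 * E1 F2 + F3 * E1 F3)%sf k = 0)
    by (intros k Hk; apply (E_vanish _ k c Hc Sa Hk)).
  pose proof (E_vanish _ g b Hb Wb Hg) as W22.
  pose proof (E_vanish _ g c Hc Wc Hg) as W33.
  pose proof (E_vanish _ g b Hb Db Hg) as D22.
  pose proof (E_vanish _ g c Hc Db Hg) as D32.
  pose proof (E_vanish _ g c Hc Dc Hg) as D33.
  pose proof (E_vanish _ g b Hb Sab Hg) as T22.
  pose proof (E_vanish _ g c Hc Sab Hg) as T32.
  pose proof (E_vanish _ g c Hc Sac Hg) as T33.
  clear Wb Wc Db Dc Sab Sac Sa Sb Sc.
  unfold fdiv in D22, D32, D33. unfold Wdiv, W1, W2, W3 in W22, W33.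
  unfold helicity, fcurl1, fcurl2, fcurl3.
  sort_in D22. sort_in D32. sort_in D33. sort_in T22. sort_in T32. sort_in T33.
  sort_in W22. sort_in W33. sort_goal.
  let pt H := (fold x y z A B in H;
   rewrite ?V1, ?V2, ?V3, ?P11, ?P21, ?P31, ?P12, ?P13, ?P33, ?Hr1,
   ?q211, ?q212, ?q213, ?q311, ?q312, ?q313, ?q221, ?q321, ?q331,
   ?q323, ?q333, ?q223, ?q332, ?HA, ?HB in H) in
  pt D22; pt D32; pt D33; pt T22; pt T32; pt T33; pt W22; pt W33.
  fold x y z A B.
  rewrite ?V1, ?V2, ?V3, ?P11, ?P21, ?P31, ?P12, ?P13, ?P33, ?Hr1,
   ?q211, ?q212, ?q213, ?q311, ?q312, ?q313, ?q221, ?q321, ?q331,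
   ?q323, ?q333, ?q223, ?q332, ?HA, ?HB.
  assert (t222 : E2 (E2 (E2 F2)) g = 2 * x * (y - z) + 4 * x - E3 (E2 (E2 F3)) g) by lra.
  assert (t333 : E3 (E3 (E3 F3)) g = - 2 * x * (y - z) - E3 (E3 (E2 F2)) g) by lra.
  assert (t322 : E3 (E2 (E2 F2)) g = (y + z) * (y - z) - 2 * (y - z) - E3 (E3 (E2 F3)) g) by lra.
  rewrite t222, t322 in W22. rewrite t333 in W33. rewrite t322.
  clear D22 D32 D33 T22 T32 T33 t222 t333 t322.
  (* Adding half the sum of the twice differentiated Monge-Ampere relations cancels all third
     derivatives; the remainder has the factor [x^2 + y z + y - z], zero by [Rel]. *)
  match type of W22 with ?u = 0 => match type of W33 with ?v = 0 =>
    match goal with |- ?l = ?m =>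
      assert (Fin : l - m + (u + v) / 2 = (x * x + y * z + y - z) * (4 * x * x + (y + z) * (y + z) - 8))
        by (clear W22 W33; field);
      replace (x * x + y * z + y - z) with 0 in Fin by lra;
      rewrite W22, W33 in Fin; lra
    end end end.
Qed.
End Adapted.
End Jets.
(** * Spinors with constant real part *)

Lemma frame_exists a : im_unit a -> exists b c, frame a b c.
Proof.
  intros [Za Na]. unfold qdot in Na.
  assert (H : exists b, im_unit b /\ qdot a b = 0).
  { destruct (Req_dec (q1 a * q1 a + q2 a * q2 a) 0) as [H0|H0].
    (* Here [a] is a multiple of [k]; otherwise a quarter turn of its [i], [j] part is
       normalised. *)
    - exists (mkQ 0 1 0 0).
      assert (Z1 : q1 a = 0) by nra. unfold im_unit, qdot; simpl. rewrite Z1. repeat split; ring.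
    - set (m := q1 a * q1 a + q2 a * q2 a) in *.
      assert (Hm : 0 < m) by (unfold m in *; nra).
      assert (Hp : 0 < sqrt m) by (apply sqrt_lt_R0; lra).
      pose proof (sqrt_sqrt m ltac:(lra)) as SS.
      exists (mkQ 0 (- q2 a / sqrt m) (q1 a / sqrt m) 0).
      unfold im_unit, qdot; simpl. repeat split.
      + transitivity ((q1 a * q1 a + q2 a * q2 a) / (sqrt m * sqrt m)); [field; lra|].
        rewrite SS. fold m. field. lra.
      + field. lra. }
  destruct H as [b [Hb O]]. exists b, (qmul a b). repeat split; try assumption; apply Hb.
Qed.

(** [G] expands a product of two triple products as a Gram determinant, with a correction in the
    real part of [a b], which is zero. *)
Lemma frame_parseval a b c u v : frame a b c -> q0 u = 0 ->
  qdot u v = qdot u a * qdot v a + qdot u b * qdot v b + qdot u c * qdot v c.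
Proof.
  intros Fr Zu. destruct Fr as [[Za Na] [[Zb Nb] [O Ec]]]. subst c.
  assert (G : qdot u (qmul a b) * qdot v (qmul a b)
    = qdot u v * (qdot a a * qdot b b - qdot a b * qdot a b)
      - qdot u a * (qdot v a * qdot b b - qdot v b * qdot a b)
      + qdot u b * (qdot v a * qdot a b - qdot v b * qdot a a)
      + q0 (qmul a b) * (q0 v * qdot u (qmul a b))).
  { unfold qdot; simpl. rewrite Za, Zb, Zu. ring. }
  assert (Z : q0 (qmul a b) = 0) by (unfold qdot in O; simpl; rewrite Za, Zb in *; lra).
  rewrite G, Z, Na, Nb, O. ring.
Qed.

(** The factor [qscale 1] gives the right-hand side the shape that [E_lin] rewrites. *)
Lemma frame_expand a b c d : frame a b c -> q0 d = 0 ->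
  d = qadd (qscale (qdot d a) a)
        (qscale 1 (qadd (qscale (qdot d b) b) (qscale (qdot d c) c))).
Proof.
  intros Fr Zd.
  pose proof (frame_third _ _ _ Fr) as [Zc _].
  assert (P := fun e => frame_parseval a b c d e Fr Zd).
  destruct Fr as [[Za _] [[Zb _] _]].
  apply quat_ext; simpl.
  - rewrite Za, Zb, Zc, Zd. ring.
  - pose proof (P (basis4 1)) as Q. unfold qdot at 1 3 5 7 in Q. simpl in Q. lra.
  - pose proof (P (basis4 2)) as Q. unfold qdot at 1 3 5 7 in Q. simpl in Q. lra.
  - pose proof (P (basis4 3)) as Q. unfold qdot at 1 3 5 7 in Q. simpl in Q. lra.
Qed.

Lemma E_expand a b c d h g : frame a b c -> q0 d = 0 ->
  E d h g = qdot d a * E a h g + qdot d b * E b h g + qdot d c * E c h g.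
Proof.
  intros Fr Zd. rewrite (frame_expand a b c d Fr Zd) at 1. rewrite !E_lin. ring.
Qed.

(* Lagrange's identity [<u x v, b x c> = <u, b> <v, c> - <u, c> <v, b>] with [b x c = a]. *)
Lemma frame_triple a b c u s : frame a b c -> q0 u = 0 ->
  qdot a (qmul u s) = q0 s * qdot u a + qdot u b * qdot s c - qdot u c * qdot s b.
Proof.
  intros Fr Zu. pose proof (frame_rot _ _ _ Fr) as [[Zb _] [[Zc _] [O Ea]]].
  destruct Fr as [[Za _] _].
  assert (A1 : q1 a = q2 b * q3 c - q3 b * q2 c) by (rewrite Ea; simpl; rewrite Zb, Zc; ring).
  assert (A2 : q2 a = q3 b * q1 c - q1 b * q3 c) by (rewrite Ea; simpl; rewrite Zb, Zc; ring).
  assert (A3 : q3 a = q1 b * q2 c - q2 b * q1 c) by (rewrite Ea; simpl; rewrite Zb, Zc; ring).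
  unfold qdot; simpl. rewrite Za, Zb, Zc, Zu, A1, A2, A3. ring.
Qed.

(** * From the generalized Killing equation to the first-order system *)

Section Spinor.

Variable f : quat -> quat.
Hypothesis Hsmooth : smooth_spinor f.

Definition f0 : SF := mkSF _ (proj1 Hsmooth).
Definition f1 : SF := mkSF _ (proj1 (proj2 Hsmooth)).
Definition f2 : SF := mkSF _ (proj1 (proj2 (proj2 Hsmooth))).
Definition f3 : SF := mkSF _ (proj2 (proj2 (proj2 Hsmooth))).

Definition comp (a : quat) : SF := (q1 a *: f1 + q2 a *: f2 + q3 a *: f3)%sf.

Lemma compE a g : q0 a = 0 -> comp a g = qdot (f g) a.
Proof. intro Za. unfold comp, qdot. ev_goal. rewrite Za. simpl. ring. Qed.

Lemma E_comp d a g :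
  E d (comp a) g = q1 a * E d f1 g + q2 a * E d f2 g + q3 a * E d f3 g.
Proof. unfold comp. jetg. reflexivity. Qed.

Lemma E_comp_expand a b c d e g : frame a b c -> q0 e = 0 ->
  E d (comp e) g = qdot e a * E d (comp a) g + qdot e b * E d (comp b) g + qdot e c * E d (comp c) g.
Proof.
  intros Fr Ze. pose proof (frame_expand a b c e Fr Ze) as X.
  rewrite !E_comp. rewrite X at 1 2 3. simpl. ring.
Qed.

Definition curl0 (g : quat) : quat :=
  mkQ 0 (E (basis4 2) f3 g - E (basis4 3) f2 g) (E (basis4 3) f1 g - E (basis4 1) f3 g)
        (E (basis4 1) f2 g - E (basis4 2) f1 g).

Lemma frame_curl a b c g : frame a b c ->
  E b (comp c) g - E c (comp b) g = qdot (curl0 g) a.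
Proof.
  intro Fr. pose proof (frame_rot _ _ _ Fr) as [[Zb _] [[Zc _] [O Ea]]].
  rewrite !E_comp, !(E_lin3 b), !(E_lin3 c) by assumption.
  rewrite Ea. unfold qdot, curl0. simpl. rewrite Zb, Zc. ring.
Qed.

Definition hel0 : SF := helicity (basis4 1) (basis4 2) (basis4 3) f1 f2 f3.

(** Adapted frames vary from point to point; frame independence makes the helicity one global
    function, to which the maximum principle applies. *)
Lemma helicity_frame a b c : frame a b c ->
  helicity a b c (comp a) (comp b) (comp c) = hel0.
Proof.
  intro Fr. apply SF_ext; intro g.
  pose proof (frame_rot _ _ _ Fr) as Fr2. pose proof (frame_rot _ _ _ Fr2) as Fr3.
  transitivity (qdot (curl0 g) (f g)).
  - rewrite (frame_parseval a b c (curl0 g) (f g) Fr eq_refl).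
    rewrite <- (frame_curl a b c g Fr), <- (frame_curl b c a g Fr2), <- (frame_curl c a b g Fr3).
    rewrite <- !compE by (apply Fr || apply Fr2 || apply Fr3).
    unfold helicity, fcurl1, fcurl2, fcurl3. ev_goal. ring.
  - unfold hel0, helicity, fcurl1, fcurl2, fcurl3. ev_goal. unfold qdot, curl0. simpl. ring.
Qed.

Lemma qconj_qmul_l g x : onS3 g -> qmul (qconj g) (qmul g x) = x.
Proof.
  intro Hg. apply onS3_sq in Hg. unfold qdot in Hg.
  apply quat_ext; simpl.
  - transitivity ((q0 g * q0 g + q1 g * q1 g + q2 g * q2 g + q3 g * q3 g) * q0 x); [ring|rewrite Hg; ring].
  - transitivity ((q0 g * q0 g + q1 g * q1 g + q2 g * q2 g + q3 g * q3 g) * q1 x); [ring|rewrite Hg; ring].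
  - transitivity ((q0 g * q0 g + q1 g * q1 g + q2 g * q2 g + q3 g * q3 g) * q2 x); [ring|rewrite Hg; ring].
  - transitivity ((q0 g * q0 g + q1 g * q1 g + q2 g * q2 g + q3 g * q3 g) * q3 x); [ring|rewrite Hg; ring].
Qed.

Lemma qmul_qconj_l g x : onS3 g -> qmul g (qmul (qconj g) x) = x.
Proof.
  intro Hg. replace g with (qconj (qconj g)) at 1 by (apply quat_ext; simpl; ring).
  apply qconj_qmul_l. apply onS3_sq. apply onS3_sq in Hg. unfold qdot in *. simpl. lra.
Qed.

Lemma dirderiv_E g a d : dirderiv f g (qmul g a) d ->
  E a f0 g = q0 d /\ E a f1 g = q1 d /\ E a f2 g = q2 d /\ E a f3 g = q3 d.
Proof.
  intros [D0 [D1 [D2 D3]]].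
  repeat split; eapply uniqueness_limite; try apply E_line; assumption.
Qed.

(** [beta] is [A] translated to the identity minus one half: the shift absorbs the connection term,
    leaving [df(g x) = beta(x) f]. *)
Lemma gen_killing_E g : gen_killing f -> onS3 g ->
  exists beta : quat -> quat,
    (forall x, q0 x = 0 -> q0 (beta x) = 0) /\
    (forall x y, q0 x = 0 -> q0 y = 0 -> qdot (beta x) y = qdot x (beta y)) /\
    (forall x, q0 x = 0 ->
       E x f0 g = q0 (qmul (beta x) (f g)) /\ E x f1 g = q1 (qmul (beta x) (f g)) /\
       E x f2 g = q2 (qmul (beta x) (f g)) /\ E x f3 g = q3 (qmul (beta x) (f g))).
Proof.
  intros [A [Sym K]] Hg. destruct (Sym g Hg) as [At [_ [_ As]]].
  assert (Tan : forall x, q0 x = 0 -> tangent g (qmul g x)).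
  { intros x Zx. unfold tangent, qdot; simpl. rewrite Zx. ring. }
  exists (fun x => qadd (qmul (qconj g) (A g (qmul g x))) (qscale (-1/2) x)).
  split; [|split].
  - intros x Zx. pose proof (At _ (Tan x Zx)) as T. unfold tangent, qdot in T.
    cbn [qadd qscale qmul qconj q0 q1 q2 q3]. rewrite Zx. lra.
  - intros x y Zx Zy. pose proof (As _ _ (Tan x Zx) (Tan y Zy)) as S.
    generalize dependent (A g (qmul g x)). intros P S.
    generalize dependent (A g (qmul g y)). intros Q S.
    unfold qdot in *. simpl in *. rewrite Zx, Zy in *. lra.
  - intros x Zx. destruct (K g _ Hg (Tan x Zx)) as [d [D Ed]].
    destruct (dirderiv_E g x d D) as [-> [-> [-> ->]]].
    unfold cliff in Ed. rewrite (qconj_qmul_l g x Hg) in Ed.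
    set (P := qmul (qconj g) (A g (qmul g x))) in *. clearbody P.
    assert (H : d = qmul (qadd P (qscale (-1/2) x)) (f g)).
    { apply quat_ext.
      - apply (f_equal q0) in Ed. simpl in Ed |- *. lra.
      - apply (f_equal q1) in Ed. simpl in Ed |- *. lra.
      - apply (f_equal q2) in Ed. simpl in Ed |- *. lra.
      - apply (f_equal q3) in Ed. simpl in Ed |- *. lra. }
    rewrite <- H. repeat split; reflexivity.
Qed.

Variable alpha : R.
Hypothesis Hunit : unit_length f.
Hypothesis Hgk : gen_killing f.
Hypothesis Halpha : forall g, onS3 g -> q0 (f g) = alpha.

Lemma f_norm g : onS3 g -> qdot (f g) (f g) = 1.
Proof. intro Hg. apply onS3_sq. exact (Hunit g Hg). Qed.

(** The real part of [beta(d) f] is [- <beta d, v>], so constant [alpha] and symmetry give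
    [beta v = 0]. The rest is read off the imaginary part [alpha beta(d) + beta(d) x v]. *)
Lemma frame_equations a b c : frame a b c ->
  forall g, onS3 g ->
  fsq (comp a) (comp b) (comp c) g = 1 - alpha * alpha /\
  DF a b c (comp a) (comp b) (comp c) (comp a) g = 0 /\
  alpha * fcurl1 b c (comp b) (comp c) g + comp a g * fdiv a b c (comp a) (comp b) (comp c) g = 0.
Proof.
  intros Fr g Hg.
  pose proof (frame_rot _ _ _ Fr) as Fr2. pose proof (frame_rot _ _ _ Fr2) as Fr3.
  pose proof Fr as [Ha [Hb _]]. pose proof Fr2 as [_ [Hc _]].
  pose proof (proj1 Ha) as Za; pose proof (proj1 Hb) as Zb; pose proof (proj1 Hc) as Zc.
  destruct (gen_killing_E g Hgk Hg) as [beta [B0 [Bs BE]]].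
  pose proof (f_norm g Hg) as N. pose proof (Halpha g Hg) as Al.
  set (v := mkQ 0 (q1 (f g)) (q2 (f g)) (q3 (f g))).
  assert (Dv : forall e, q0 e = 0 -> qdot (f g) e = qdot v e)
    by (intros e Ze; unfold qdot, v; simpl; rewrite Ze; ring).
  assert (EE : forall d e, q0 d = 0 -> q0 e = 0 -> E d (comp e) g = qdot e (qmul (beta d) (f g))).
  { intros d e Zd Ze. rewrite E_comp. destruct (BE d Zd) as [_ [-> [-> ->]]].
    unfold qdot. rewrite Ze. ring. }
  assert (Z : forall d, im_unit d -> qdot (beta d) v = 0).
  { intros d Hd. pose proof (E_locally_const f0 alpha d g Hd Halpha Hg) as K.
    destruct (BE d (proj1 Hd)) as [E0 _]. rewrite E0 in K.
    pose proof (B0 d (proj1 Hd)) as Zd. unfold qdot, v. simpl in K |- *. rewrite Zd in *. lra. }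
  assert (ZZ : forall d, im_unit d ->
    qdot (beta d) a * comp a g + qdot (beta d) b * comp b g + qdot (beta d) c * comp c g = 0).
  { intros d Hd. rewrite !compE by assumption. rewrite !Dv by assumption.
    rewrite <- (frame_parseval a b c (beta d) v Fr (B0 d (proj1 Hd))). apply Z, Hd. }
  assert (T1 : forall d, q0 d = 0 -> E d (comp a) g
     = alpha * qdot (beta d) a + qdot (beta d) b * comp c g - qdot (beta d) c * comp b g).
  { intros d Zd. rewrite EE, (frame_triple a b c _ _ Fr (B0 d Zd)), Al, !compE by assumption. ring. }
  assert (T2 : forall d, q0 d = 0 -> E d (comp b) g
     = alpha * qdot (beta d) b + qdot (beta d) c * comp a g - qdot (beta d) a * comp c g).
  { intros d Zd. rewrite EE, (frame_triple b c a _ _ Fr2 (B0 d Zd)), Al, !compE by assumption. ring. }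
  assert (T3 : forall d, q0 d = 0 -> E d (comp c) g
     = alpha * qdot (beta d) c + qdot (beta d) a * comp b g - qdot (beta d) b * comp a g).
  { intros d Zd. rewrite EE, (frame_triple c a b _ _ Fr3 (B0 d Zd)), Al, !compE by assumption. ring. }
  assert (Sm : forall x y, q0 x = 0 -> q0 y = 0 -> qdot (beta x) y = qdot (beta y) x).
  { intros x y Zx Zy. rewrite (Bs x y Zx Zy). unfold qdot. ring. }
  pose proof (ZZ a Ha) as Za'; pose proof (ZZ b Hb) as Zb'; pose proof (ZZ c Hc) as Zc'.
  rewrite (Sm b a), (Sm c a), (Sm c b) in * by assumption.
  repeat split.
  - unfold fsq. ev_goal. rewrite !compE, !Dv by assumption.
    rewrite <- (frame_parseval a b c v v Fr eq_refl).
    unfold qdot in N |- *. unfold v. simpl. rewrite Al in N. lra.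
  - unfold DF. ev_goal. rewrite !T1 by assumption.
    rewrite (Sm b a), (Sm c a), (Sm c b) by assumption.
    transitivity (alpha * (qdot (beta a) a * comp a g + qdot (beta a) b * comp b g + qdot (beta a) c * comp c g)
      + comp c g * (qdot (beta a) b * comp a g + qdot (beta b) b * comp b g + qdot (beta b) c * comp c g)
      - comp b g * (qdot (beta a) c * comp a g + qdot (beta b) c * comp b g + qdot (beta c) c * comp c g));
    [ring|]. rewrite Za', Zb', Zc'. ring.
  (* In invariant form, [curl v = beta v - (tr beta) v] and [div v = alpha tr beta]. *)
  - unfold fcurl1, fdiv. ev_goal. rewrite T1, !T2, !T3 by assumption.
    rewrite (Sm b a), (Sm c a), (Sm c b) by assumption.
    transitivity (alpha * (qdot (beta a) a * comp a g + qdot (beta a) b * comp b g + qdot (beta a) c * comp c g)); [ring|].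
    rewrite Za'. ring.
Qed.

(** The remaining components come from cyclic rotations of the frame. *)
Lemma frame_system a b c : frame a b c ->
  let F1 := comp a in let F2 := comp b in let F3 := comp c in
  (forall g, onS3 g -> fsq F1 F2 F3 g = 1 - alpha * alpha) /\
  (forall g, onS3 g -> DF a b c F1 F2 F3 F1 g = 0) /\
  (forall g, onS3 g -> DF a b c F1 F2 F3 F2 g = 0) /\
  (forall g, onS3 g -> DF a b c F1 F2 F3 F3 g = 0) /\
  (forall g, onS3 g -> alpha * fcurl1 b c F2 F3 g + F1 g * fdiv a b c F1 F2 F3 g = 0) /\
  (forall g, onS3 g -> alpha * fcurl2 a c F1 F3 g + F2 g * fdiv a b c F1 F2 F3 g = 0) /\
  (forall g, onS3 g -> alpha * fcurl3 a b F1 F2 g + F3 g * fdiv a b c F1 F2 F3 g = 0).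
Proof.
  intros Fr. cbv zeta.
  pose proof (frame_rot _ _ _ Fr) as Fr2. pose proof (frame_rot _ _ _ Fr2) as Fr3.
  repeat split; intros g Hg;
  destruct (frame_equations a b c Fr g Hg) as [A1 [A2 A3]];
  destruct (frame_equations b c a Fr2 g Hg) as [B1 [B2 B3]];
  destruct (frame_equations c a b Fr3 g Hg) as [C1 [C2 C3]]; try assumption;
  unfold DF, fcurl1, fcurl2, fcurl3, fdiv in *; ev_in B2; ev_in B3; ev_in C2; ev_in C3;
  ev_goal; lra.
Qed.

Lemma adapted_frame r g : 0 < r -> r * r = 1 - alpha * alpha -> onS3 g ->
  exists a b c, frame a b c /\ comp a g = r /\ comp b g = 0 /\ comp c g = 0 /\
    f g = qadd (qreal alpha) (qscale r a).
Proof.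
  intros Hr Er Hg. pose proof (f_norm g Hg) as N. pose proof (Halpha g Hg) as Al.
  unfold qdot in N. rewrite Al in N.
  set (a := mkQ 0 (q1 (f g) / r) (q2 (f g) / r) (q3 (f g) / r)).
  assert (Ha : im_unit a).
  { split; [reflexivity|]. unfold qdot, a; simpl.
    transitivity ((q1 (f g) * q1 (f g) + q2 (f g) * q2 (f g) + q3 (f g) * q3 (f g)) / (r * r));
      [field; lra|].
    replace (q1 (f g) * q1 (f g) + q2 (f g) * q2 (f g) + q3 (f g) * q3 (f g)) with (r * r) by lra.
    field. lra. }
  assert (Ef : f g = qadd (qreal alpha) (qscale r a)).
  { apply quat_ext; unfold a; simpl; rewrite ?Al; field; lra. }
  destruct (frame_exists a Ha) as [b [c Fr]]. exists a, b, c.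
  pose proof (frame_rot _ _ _ Fr) as Fr2. pose proof (frame_rot _ _ _ Fr2) as Fr3.
  pose proof Fr as [_ [Hb [Oab _]]]. pose proof Fr3 as [Hc [_ [Oca _]]].
  assert (K : forall e, q0 e = 0 -> comp e g = r * qdot e a).
  { intros e Ze. rewrite compE, Ef by exact Ze. unfold qdot. simpl. rewrite Ze. ring. }
  split; [exact Fr|]. rewrite !K by (apply Ha || apply Hb || apply Hc).
  destruct Ha as [Za Na].
  replace (qdot b a) with (qdot a b) by (unfold qdot; ring).
  rewrite Na, Oab, Oca. repeat split; try ring. exact Ef.
Qed.

(** When [f] has zero derivative along the sphere, only the connection term [1/2 X . f] is left; the
    real part is covered by the constancy of [alpha]. *)
Lemma killing_of_E_zero :
  (forall g d, onS3 g -> im_unit d -> E d f1 g = 0 /\ E d f2 g = 0 /\ E d f3 g = 0) ->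
  killing f (1/2).
Proof.
  intros H g X Hg HX.
  set (x := qmul (qconj g) X).
  assert (Zx : q0 x = 0) by (unfold x; unfold tangent, qdot in HX; simpl; lra).
  assert (EX : X = qmul g x) by (unfold x; rewrite qmul_qconj_l; [reflexivity|exact Hg]).
  exists (qreal 0). split.
  - rewrite EX.
    assert (I1 : im_unit (basis4 1)) by (unfold im_unit, qdot; simpl; split; ring).
    assert (I2 : im_unit (basis4 2)) by (unfold im_unit, qdot; simpl; split; ring).
    assert (I3 : im_unit (basis4 3)) by (unfold im_unit, qdot; simpl; split; ring).
    destruct (H g _ Hg I1) as [A1 [A2 A3]]. destruct (H g _ Hg I2) as [B1 [B2 B3]].
    destruct (H g _ Hg I3) as [C1 [C2 C3]].
    assert (Z0 : E x f0 g = 0).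
    { rewrite E_lin3 by exact Zx.
      rewrite !(E_locally_const f0 alpha _ g) by assumption. ring. }
    assert (Z1 : E x f1 g = 0) by (rewrite E_lin3, A1, B1, C1 by exact Zx; ring).
    assert (Z2 : E x f2 g = 0) by (rewrite E_lin3, A2, B2, C2 by exact Zx; ring).
    assert (Z3 : E x f3 g = 0) by (rewrite E_lin3, A3, B3, C3 by exact Zx; ring).
    pose proof (E_line x f0 g) as D0; pose proof (E_line x f1 g) as D1;
    pose proof (E_line x f2 g) as D2; pose proof (E_line x f3 g) as D3.
    rewrite Z0 in D0; rewrite Z1 in D1; rewrite Z2 in D2; rewrite Z3 in D3.
    repeat split; assumption.
  - apply quat_ext; simpl; ring.
Qed.

Lemma E_zero_of_jet a b c g : frame a b c ->
  (forall d, d = a \/ d = b \/ d = c ->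
     E d (comp a) g = 0 /\ E d (comp b) g = 0 /\ E d (comp c) g = 0) ->
  forall d, q0 d = 0 -> E d f1 g = 0 /\ E d f2 g = 0 /\ E d f3 g = 0.
Proof.
  intros Fr H d Zd.
  assert (K : forall e, q0 e = 0 -> E d (comp e) g = 0).
  { intros e Ze. rewrite (E_expand a b c d (comp e) g Fr Zd).
    rewrite !(E_comp_expand a b c _ e g Fr Ze).
    destruct (H a) as [-> [-> ->]]; [tauto|]. destruct (H b) as [-> [-> ->]]; [tauto|].
    destruct (H c) as [-> [-> ->]]; [tauto|]. ring. }
  pose proof (K (basis4 1) eq_refl) as K1. pose proof (K (basis4 2) eq_refl) as K2.
  pose proof (K (basis4 3) eq_refl) as K3. rewrite E_comp in K1, K2, K3.
  cbn [basis4 q1 q2 q3] in K1, K2, K3.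
  repeat split; lra.
Qed.

Lemma killing_alpha_nonzero r : 0 < r -> r * r = 1 - alpha * alpha -> alpha <> 0 ->
  killing f (1/2).
Proof.
  intros Hr Er Hal. apply killing_of_E_zero. intros g d Hg Hd.
  destruct (adapted_frame r g Hr Er Hg) as [a [b [c [Fr [V1 [V2 [V3 _]]]]]]].
  destruct (frame_system a b c Fr) as [S [D1 [D2 [D3 [C1 [C2 C3]]]]]].
  rewrite <- Er in S.
  destruct (jet_zero_of_alpha a b c (comp a) (comp b) (comp c) r alpha Fr S D1 D2 D3 C1 C2 C3
             g Hg Hr V1 V2 V3 Hal) as [P22 [P23 [P32 P33]]].
  assert (P1 : forall e, im_unit e -> E e (comp a) g = 0)
    by (intros e He; apply (jet_first (comp a) (comp b) (comp c) r S g Hg Hr V1 V2 V3 e He)).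
  apply (E_zero_of_jet a b c g Fr); [|apply Hd].
  pose proof (jet_along a b c (comp a) (comp b) (comp c) r g Hg Hr V1 V2 V3 (comp b) D2) as P12.
  pose proof (jet_along a b c (comp a) (comp b) (comp c) r g Hg Hr V1 V2 V3 (comp c) D3) as P13.
  pose proof (frame_third a b c Fr) as Hc. destruct Fr as [Ha [Hb _]].
  intros e [E'|[E'|E']]; subst e; rewrite P1 by assumption; tauto.
Qed.

Lemma killing_scalar : alpha * alpha = 1 -> killing f (1/2).
Proof.
  intro Ha. apply killing_of_E_zero. intros g d Hg Hd.
  assert (Z : forall k, onS3 k -> f1 k = 0 /\ f2 k = 0 /\ f3 k = 0).
  { intros k Hk. pose proof (f_norm k Hk) as N. unfold qdot in N. rewrite (Halpha k Hk), Ha in N.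
    simpl. repeat split; nra. }
  repeat split; apply E_vanish; try assumption; intros k Hk; apply Z, Hk.
Qed.

(** * The case of vanishing real part *)

Section ZeroAlpha.

Hypothesis Hal : alpha = 0.

Lemma unit_speed : 1 * 1 = 1 - alpha * alpha.
Proof. rewrite Hal. ring. Qed.

Lemma adapted_jet g : onS3 g -> exists a b c,
  frame a b c /\ f g = a /\
  (forall d, im_unit d -> E d (comp a) g = 0) /\ E a (comp b) g = 0 /\ E a (comp c) g = 0 /\
  E c (comp c) g = - E b (comp b) g /\ hel0 g = E b (comp c) g - E c (comp b) g /\
  E b (comp b) g * E b (comp b) g
    = - E b (comp c) g * E c (comp b) g - E b (comp c) g + E c (comp b) g /\
  (E b hel0 g = 0 -> E c hel0 g = 0 -> hel0 g * hel0 g - 4 * hel0 g <> 0 ->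
  (1 + E c (comp b) g) * E b (E b hel0) g - 2 * E b (comp b) g * E c (E b hel0) g
  + (1 - E b (comp c) g) * E c (E c hel0) g
  = - 2 * (hel0 g * hel0 g - 4 * hel0 g)).
Proof.
  intro Hg.
  destruct (adapted_frame 1 g Rlt_0_1 unit_speed Hg) as [a [b [c [Fr [V1 [V2 [V3 Ef]]]]]]].
  destruct (frame_system a b c Fr) as [S [D1 [D2 [D3 [C1 [C2 C3]]]]]].
  rewrite <- unit_speed in S.
  exists a, b, c. split; [exact Fr|]. split.
  { rewrite Ef, Hal. apply quat_ext; simpl; ring. }
  split. { intros e He; apply (jet_first (comp a) (comp b) (comp c) 1 S g Hg Rlt_0_1 V1 V2 V3 e He). }
  split. { apply (jet_along a b c (comp a) (comp b) (comp c) 1 g Hg Rlt_0_1 V1 V2 V3 (comp b) D2). }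
  split. { apply (jet_along a b c (comp a) (comp b) (comp c) 1 g Hg Rlt_0_1 V1 V2 V3 (comp c) D3). }
  destruct (adapted_relations a b c (comp a) (comp b) (comp c) 1 alpha Fr S D1 D2 D3 C1 C2 C3
             g Hg Rlt_0_1 V1 V2 V3 Hal eq_refl) as [R1 [R2 R3]].
  rewrite (helicity_frame a b c Fr) in R2.
  split; [exact R1|]. split; [exact R2|]. split; [exact R3|].
  intros K2 K3 Nz.
  pose proof (critical_hessian a b c (comp a) (comp b) (comp c) 1 alpha Fr S D1 D2 D3 C1 C2 C3
             g Hg Rlt_0_1 V1 V2 V3 Hal eq_refl) as CH.
  rewrite (helicity_frame a b c Fr) in CH. apply CH; assumption.
Qed.

(** Maximise [(hel0 - 2)^2], which exceeds 4 exactly where the bound fails. If it does at the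
    maximum, then [hel0] is critical there and [w Hess(hel0) >= 0] with [w = 2 - hel0]. The matrix
    [w (1 + z, -x; -x, 1 - y)] is positive definite, so its pairing with this Hessian is
    nonnegative, whereas [critical_hessian] makes it negative. *)
Lemma hel_range g : onS3 g -> hel0 g * hel0 g - 4 * hel0 g <= 0.
Proof.
  set (K := ((hel0 + sconst (-2)) * (hel0 + sconst (-2)))%sf).
  destruct (S3_max K (smooth_cont K (sf_smooth K))) as [m [Hm Max]].
  assert (KE : forall k, K k = hel0 k * hel0 k - 4 * hel0 k + 4)
    by (intro k; unfold K; ev_goal; ring).
  intro Hg. pose proof (Max g Hg) as Mg. rewrite !KE in Mg.
  apply Rle_trans with (hel0 m * hel0 m - 4 * hel0 m); [lra|].
  apply Rnot_lt_le. intro Pos.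
  set (w := 2 - hel0 m). assert (Hw : w <> 0) by (unfold w; intro; nra).
  assert (Crit : forall d, im_unit d -> E d hel0 m = 0).
  { intros d Hd. destruct (S3_max_test K m d Hd Hm Max) as [T _]. unfold K in T. jet T.
    apply Rmult_eq_reg_l with w; [|exact Hw]. unfold w. lra. }
  assert (Hess : forall d, im_unit d -> 0 <= w * E d (E d hel0) m).
  { intros d Hd. destruct (S3_max_test K m d Hd Hm Max) as [_ T]. unfold K in T. jet T.
    rewrite (Crit d Hd) in T. unfold w. lra. }
  destruct (adapted_jet m Hm) as [a [b [c [Fr [_ [_ [_ [_ [_ [Hh [Rel CH]]]]]]]]]]].
  pose proof (frame_rot _ _ _ Fr) as Fr2. pose proof Fr as [Ha [Hb _]].
  pose proof Fr2 as [_ [Hc [Obc _]]].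
  assert (CH' := CH (Crit b Hb) (Crit c Hc) ltac:(lra)). clear CH.
  set (x := E b (comp b) m) in *. set (y := E b (comp c) m) in *. set (z := E c (comp b) m) in *.
  set (H22 := E b (E b hel0) m) in *. set (H32 := E c (E b hel0) m) in *.
  set (H33 := E c (E c hel0) m) in *.
  (* The commutator contributes [2 E a hel0], zero at the critical point, so the Hessian is
     symmetric. *)
  assert (H23 : E b (E c hel0) m = H32).
  { rewrite (E_frame_comm b c a hel0 Fr2). ev_goal. rewrite (Crit a Ha). unfold H32. ring. }
  assert (Quad : forall s t, 0 <= w * (s * s * H22 + 2 * (s * t) * H32 + t * t * H33)).
  { intros s t. destruct (Req_dec (s * s + t * t) 0) as [Z|Z].
    - assert (s = 0) by nra. assert (t = 0) by nra. subst. right. ring.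
    - set (n := sqrt (s * s + t * t)).
      assert (Hn : 0 < n) by (apply sqrt_lt_R0; nra).
      assert (Nn : n * n = s * s + t * t) by (apply sqrt_sqrt; nra).
      set (d := qadd (qscale (s / n) b) (qscale (t / n) c)).
      assert (Hd : im_unit d).
      { destruct Hb as [Zb Nb], Hc as [Zc Nc]. split.
        - unfold d. simpl. rewrite Zb, Zc. ring.
        - transitivity ((s / n) * (s / n) * qdot b b + 2 * (s / n) * (t / n) * qdot b c
                        + (t / n) * (t / n) * qdot c c); [unfold d, qdot; simpl; ring|].
          rewrite Nb, Nc, Obc. transitivity ((s * s + t * t) / (n * n)); [field; lra|].
          rewrite <- Nn. field. lra. }
      pose proof (Hess d Hd) as P.
      assert (X : E d (E d hel0) m = (s * s * H22 + 2 * (s * t) * H32 + t * t * H33) / (n * n)).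
      { unfold d at 1. rewrite E_lin.
        assert (Y : E d hel0 = ((s / n) *: E b hel0 + (t / n) *: E c hel0)%sf)
          by (apply SF_ext; intro k; unfold d; rewrite E_lin; ev_goal; reflexivity).
        rewrite Y. jetg. rewrite H23. unfold H22, H32, H33. field. lra. }
      rewrite X in P.
      apply Rmult_le_reg_r with (/ (n * n)); [apply Rinv_0_lt_compat; nra|].
      unfold Rdiv in P. lra. }
  (* The first row of the definite matrix and the last basis vector: since [Det] equals 1, [I]
     completes the square with them. *)
  pose proof (Quad (w * (1 + z)) (- w * x)) as Q1. pose proof (Quad 0 1) as Q2.
  assert (Wyz : w = 2 + z - y) by (unfold w; lra).
  assert (Det : (1 + z) * (1 - y) - x * x = 1) by lra.
  (* [w (1 + z)] and [w (1 - y)] have sum [w^2] and product [w^2 + w^2 x^2], both positive. *)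
  assert (Pw : 0 < w * (1 + z)).
  { assert (0 < w * w) by nra.
    assert (w * (1 + z) + w * (1 - y) = w * w) by (rewrite Wyz; ring).
    assert ((w * (1 + z)) * (w * (1 - y)) = w * w + (w * x) * (w * x)).
    { transitivity (w * w * ((1 + z) * (1 - y) - x * x) + (w * x) * (w * x)); [ring|].
      rewrite Det. ring. }
    nra. }
  set (L := (1 + z) * H22 - 2 * x * H32 + (1 - y) * H33) in *.
  assert (I : (w * (1 + z)) * (w * w * L) =
     w * (w * (1 + z) * (w * (1 + z)) * H22 + 2 * (w * (1 + z) * (- w * x)) * H32
          + - w * x * (- w * x) * H33) + w * w * (w * H33)).
  { unfold L.
    transitivity (w * (w * (1 + z) * (w * (1 + z)) * H22 + 2 * (w * (1 + z) * (- w * x)) * H32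
          + - w * x * (- w * x) * H33) + w * w * (w * H33) * ((1 + z) * (1 - y) - x * x)); [ring|].
    rewrite Det. ring. }
  assert (Pww : 0 < w * w) by nra.
  assert (Q3 : 0 <= w * w * (w * H33)) by (apply Rmult_le_pos; lra).
  assert (Ln : 0 < - L) by lra.
  pose proof (Rmult_lt_0_compat _ _ Pw (Rmult_lt_0_compat _ _ Pww Ln)) as Neg.
  replace (w * w * - L) with (- (w * w * L)) in Neg by ring.
  rewrite Ropp_mult_distr_r_reverse, I in Neg. lra.
Qed.

(** By [hel_range] the sum of squares [4 x^2 + (y + z)^2] is zero, so the derivative of the field is
    [hel0 / 2] times the quarter turn of the plane orthogonal to it. *)
Lemma jet_zero_alpha g : onS3 g -> exists a b c,
  frame a b c /\ f g = a /\ (hel0 g = 0 \/ hel0 g = 4) /\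
  forall d e, q0 d = 0 -> q0 e = 0 ->
    E d (comp e) g = hel0 g / 2 * (qdot d b * qdot e c - qdot d c * qdot e b).
Proof.
  intro Hg. pose proof (hel_range g Hg) as Rg.
  destruct (adapted_jet g Hg) as [a [b [c [Fr [Ef [P1 [P12 [P13 [P33 [Hh [Rel _]]]]]]]]]]].
  exists a, b, c. split; [exact Fr|]. split; [exact Ef|].
  set (x := E b (comp b) g) in *. set (y := E b (comp c) g) in *. set (z := E c (comp b) g) in *.
  assert (Sq : 4 * x * x + (y + z) * (y + z) = hel0 g * hel0 g - 4 * hel0 g) by (rewrite Hh; lra).
  assert (Sq' : 4 * (x * x) + (y + z) * (y + z) <= 0) by lra.
  pose proof (Rle_0_sqr x) as X2. pose proof (Rle_0_sqr (y + z)) as YZ2. unfold Rsqr in X2, YZ2.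
  assert (x0 : x = 0) by (apply Rsqr_0_uniq; unfold Rsqr; lra).
  assert (yz : y + z = 0) by (apply Rsqr_0_uniq; unfold Rsqr; lra).
  split.
  { assert (hel0 g * (hel0 g - 4) = 0) by (rewrite x0, yz in Sq; lra).
    destruct (Rmult_integral _ _ H); [left|right]; lra. }
  intros d e Zd Ze.
  pose proof (frame_third a b c Fr) as Hc. pose proof Fr as [Ha [Hb _]].
  rewrite (E_expand a b c d (comp e) g Fr Zd), !(E_comp_expand a b c _ e g Fr Ze).
  rewrite !P1 by assumption. rewrite P12, P13, P33. fold x y z.
  rewrite x0, Hh. replace z with (- y) by lra. field.
Qed.

(** As [hel0] takes only the values 0 and 4, [(hel0 - 2)^2] is constant; differentiating it and
    dividing by [hel0 - 2] shows that [hel0] has zero derivative. *)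
Lemma hel_constant g : onS3 g -> hel0 g = hel0 (qreal 1).
Proof.
  apply S3_constant. intros k Hk.
  assert (C : forall q, onS3 q -> ((hel0 + sconst (-2)) * (hel0 + sconst (-2)))%sf q = 4).
  { intros q Hq. ev_goal. destruct (jet_zero_alpha q Hq) as [a [b [c [_ [_ [[->| ->] _]]]]]]; ring. }
  assert (Z : forall d, im_unit d -> E d hel0 k = 0).
  { intros d Hd. pose proof (E_locally_const _ 4 d k Hd C Hk) as T. jet T.
    destruct (jet_zero_alpha k Hk) as [a [b [c [_ [_ [[H|H] _]]]]]]; rewrite H in T; lra. }
  repeat split; apply Z; unfold im_unit, qdot; simpl; split; ring.
Qed.

(* The components of [g (Im f) g^-1]: the field [g Im f] in the right-invariant frame. *)
Definition w1 : SF :=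
  ((scoord 0 * scoord 0 + scoord 1 * scoord 1 - scoord 2 * scoord 2 - scoord 3 * scoord 3) * f1
   + 2 *: ((scoord 1 * scoord 2 - scoord 0 * scoord 3) * f2)
   + 2 *: ((scoord 1 * scoord 3 + scoord 0 * scoord 2) * f3))%sf.
Definition w2 : SF :=
  ((scoord 0 * scoord 0 - scoord 1 * scoord 1 + scoord 2 * scoord 2 - scoord 3 * scoord 3) * f2
   + 2 *: ((scoord 1 * scoord 2 + scoord 0 * scoord 3) * f1)
   + 2 *: ((scoord 2 * scoord 3 - scoord 0 * scoord 1) * f3))%sf.
Definition w3 : SF :=
  ((scoord 0 * scoord 0 - scoord 1 * scoord 1 - scoord 2 * scoord 2 + scoord 3 * scoord 3) * f3
   + 2 *: ((scoord 1 * scoord 3 - scoord 0 * scoord 2) * f1)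
   + 2 *: ((scoord 2 * scoord 3 + scoord 0 * scoord 1) * f2))%sf.

(** The hypothesis is [dv = v d - d v], the equation satisfied by [conj(g) b g]; it says that
    [g v conj(g)] does not change. *)
Lemma right_frame_constant :
  (forall g d, onS3 g -> q0 d = 0 ->
     E d f1 g = 2 * (f2 g * q3 d - f3 g * q2 d) /\
     E d f2 g = 2 * (f3 g * q1 d - f1 g * q3 d) /\
     E d f3 g = 2 * (f1 g * q2 d - f2 g * q1 d)) ->
  forall g, onS3 g ->
    w1 g = w1 (qreal 1) /\ w2 g = w2 (qreal 1) /\ w3 g = w3 (qreal 1).
Proof.
  intros H g Hg.
  assert (D : forall k d, onS3 k -> q0 d = 0 -> E d w1 k = 0 /\ E d w2 k = 0 /\ E d w3 k = 0).
  { intros k d Hk Zd. destruct (H k d Hk Zd) as [A1 [A2 A3]].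
    split; [|split]; [unfold w1|unfold w2|unfold w3]; jetg; rewrite !E_coord, A1, A2, A3;
    unfold coord; cbn [qmul q0 q1 q2 q3 sf scoord coord]; rewrite Zd; ring. }
  split; [|split]; (apply S3_constant; [intros k Hk|exact Hg]);
  pose proof (D k (basis4 1) Hk eq_refl) as [X1 [X2 X3]];
  pose proof (D k (basis4 2) Hk eq_refl) as [Y1 [Y2 Y3]];
  pose proof (D k (basis4 3) Hk eq_refl) as [Z1 [Z2 Z3]].
  - exact (conj X1 (conj Y1 Z1)).
  - exact (conj X2 (conj Y2 Z2)).
  - exact (conj X3 (conj Y3 Z3)).
Qed.

Lemma zero_alpha_dichotomy :
  killing f (1/2) \/
  exists b : quat, q0 b = 0 /\ qnorm b = 1 /\
    forall g, onS3 g -> f g = cliff g (qmul b g) qone.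
Proof.
  assert (H1 : onS3 (qreal 1)) by (apply onS3_sq; unfold qdot; simpl; ring).
  destruct (jet_zero_alpha (qreal 1) H1) as [_ [_ [_ [_ [_ [[K|K] _]]]]]].
  - left. apply killing_of_E_zero. intros g d Hg Hd.
    destruct (jet_zero_alpha g Hg) as [a [b [c [_ [_ [_ J]]]]]].
    assert (Z : forall e, q0 e = 0 -> E d (comp e) g = 0).
    { intros e Ze. rewrite J, (hel_constant g Hg), K by (assumption || apply Hd). field. }
    pose proof (Z (basis4 1) eq_refl) as Z1. pose proof (Z (basis4 2) eq_refl) as Z2.
    pose proof (Z (basis4 3) eq_refl) as Z3. rewrite E_comp in Z1, Z2, Z3.
    cbn [basis4 q1 q2 q3] in Z1, Z2, Z3. split; [|split]; lra.
  (* The formula [f g = conj(g) b g] at [g = 1] forces this [b]. *)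
  - right. exists (f (qreal 1)).
    split; [rewrite Halpha, Hal; [reflexivity|exact H1]|].
    split; [apply Hunit, H1|]. intros g Hg.
    destruct (right_frame_constant) with (g := g) as [W1' [W2' W3']]; [|exact Hg|].
    + clear g Hg. intros g d Hg Zd.
      destruct (jet_zero_alpha g Hg) as [a [b [c [Fr [Ef [_ J]]]]]].
      (* For helicity 4 the jet is twice a triple product, a form free of the frame chosen at
         [g]. *)
      assert (Z : forall e, q0 e = 0 -> E d (comp e) g = 2 * qdot (f g) (qmul d e)).
      { intros e Ze. rewrite J, (hel_constant g Hg), K, Ef by assumption.
        rewrite (frame_triple a b c d e Fr Zd), Ze. field. }
      pose proof (Z (basis4 1) eq_refl) as Z1. pose proof (Z (basis4 2) eq_refl) as Z2.
      pose proof (Z (basis4 3) eq_refl) as Z3. rewrite E_comp in Z1, Z2, Z3.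
      unfold qdot in Z1, Z2, Z3. cbn [basis4 q0 q1 q2 q3 qmul] in Z1, Z2, Z3.
      change (q1 (f g)) with (f1 g) in *. change (q2 (f g)) with (f2 g) in *.
      change (q3 (f g)) with (f3 g) in *. rewrite Zd, (Halpha g Hg), Hal in Z1, Z2, Z3.
      split; [|split]; lra.
    + pose proof (Halpha g Hg) as A0. pose proof (Halpha _ H1) as A1. rewrite Hal in A0, A1.
      apply onS3_sq in Hg. unfold qdot in Hg.
      (* Undoing the conjugation by [g] produces the factor [|g|^4 = 1]. *)
      assert (N : forall u, u = (q0 g * q0 g + q1 g * q1 g + q2 g * q2 g + q3 g * q3 g)
               * (q0 g * q0 g + q1 g * q1 g + q2 g * q2 g + q3 g * q3 g) * u)
        by (intro u; rewrite Hg; ring).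
      unfold w1, w2, w3 in W1', W2', W3'. ev_in W1'. ev_in W2'. ev_in W3'.
      set (b := f (qreal 1)) in *.
      change (f1 (qreal 1)) with (q1 b) in *. change (f2 (qreal 1)) with (q2 b) in *.
      change (f3 (qreal 1)) with (q3 b) in *. clearbody b.
      cbn [sf f1 f2 f3 scoord coord qreal q0 q1 q2 q3] in W1', W2', W3'.
      ring_simplify in W1'. ring_simplify in W2'. ring_simplify in W3'.
      apply quat_ext; unfold cliff, qone;
        cbn [qmul qconj qreal q0 q1 q2 q3]; rewrite ?A0, ?A1, <- ?W1', <- ?W2', <- ?W3'.
      * ring.
      * rewrite (N (q1 (f g))) at 1. ring.
      * rewrite (N (q2 (f g))) at 1. ring.
      * rewrite (N (q3 (f g))) at 1. ring.
Qed.

End ZeroAlpha.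

End Spinor.

Theorem theorem5p2 (f : quat -> quat)
  (Hsmooth : smooth_spinor f)
  (Hunit : unit_length f)
  (Hgk : gen_killing f)
  (Halpha : exists c : R, forall g, onS3 g -> spinor_alpha f g = c) :
  killing f (1/2)
  \/
  ((forall g, onS3 g -> spinor_alpha f g = 0) /\
   exists b : quat, q0 b = 0 /\ qnorm b = 1 /\
     forall g, onS3 g -> f g = cliff g (qmul b g) qone).
Proof.
  destruct Halpha as [alpha Hal].
  destruct (Req_dec alpha 0) as [Z|Z].
  - destruct (zero_alpha_dichotomy f Hsmooth alpha Hunit Hgk Hal Z) as [K|K]; [left; exact K|].
    right. split; [|exact K]. intros g Hg. rewrite (Hal g Hg). exact Z.
  - left. destruct (Req_dec (alpha * alpha) 1) as [O|O].
    + exact (killing_scalar f Hsmooth alpha Hunit Hal O).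
    (* Unit length at a single point gives [alpha^2 <= 1], and equality is excluded in this
       branch. *)
    + assert (H1 : onS3 (qreal 1)) by (apply onS3_sq; unfold qdot; simpl; ring).
      pose proof (f_norm f Hunit _ H1) as N. unfold qdot in N.
      change (forall g, onS3 g -> q0 (f g) = alpha) in Hal. rewrite (Hal _ H1) in N.
      assert (P : 0 < 1 - alpha * alpha) by nra.
      apply (killing_alpha_nonzero f Hsmooth alpha Hunit Hgk Hal (sqrt (1 - alpha * alpha)));
        [apply sqrt_lt_R0; exact P|apply sqrt_sqrt; lra|exact Z].
Qed.
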